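(* For every partition $\lambda=(\lambda_1,\dots,\lambda_n)$ with at most $n$ nonzero parts, $$E^*_{\lambda^{\mathrm{rev}}}(x_1,\dots,x_n;1,t)=e^*_{\lambda'}(x_1,\dots,x_n;t),$$ where $\lambda^{\mathrm{rev}}=(\lambda_n,\dots,\lambda_1)$, $\lambda'$ is the conjugate partition and $e^*_{\lambda'}=\prod_i e^*_{\lambda'_i}$.
   Context: For $\nu\in\mathbb N^n$ let $k_i(\nu)=\#\{j<i:\nu_j>\nu_i\}+\#\{j>i:\nu_j\ge\nu_i\}$ and $\overline\nu=(q^{\nu_1}t^{-k_1(\nu)},\dots,q^{\nu_n}t^{-k_n(\nu)})$. Nonsymmetric interpolation Macdonald polynomial: for $\mu\in\mathbb N^n$ with $|\mu|=d$, $E^*_\mu(\boldsymbol{x};q,t)$ is the unique polynomial of degree at most $d$ with coefficient of $x^\mu$ equal to $1$ and $E^*_\mu(\overline\nu)=0$ for all $\nu\in\mathbb N^n$ with $|\nu|\le d$, $\nu\ne\mu$. Elementary interpolation polynomials: $e^*_k(x_1,\dots,x_n;t)=\sum_{S\subseteq\{1,\dots,n\},\#S=k}\prod_{i\in S}\left(x_i-\frac{t^{\#(S^c\cap\{1,\dots,i-1\})}}{t^{n-1}}\right)$, $e^*_0=1$. *)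

(* Defs.v *)
From mathcomp Require Import all_boot all_order all_algebra.
From mathcomp Require Import fraction mpoly.

Set Implicit Arguments.
Unset Strict Implicit.
Unset Printing Implicit Defensive.

Import GRing.Theory.
Local Open Scope ring_scope.

(* Q(q,t) is realised as Q(t)(q), so that setting q = 1 is evaluation at 1 of
   the outer polynomial variable. *)
Notation Qt := {fraction {poly rat}}.
Notation Qqt := {fraction {poly Qt}}.

Definition t_ : Qt := tofrac ('X : {poly rat}).
Definition q_ : Qqt := tofrac ('X : {poly Qt}).
Definition tq_ : Qqt := tofrac (t_%:P).

Definition comp_k (n : nat) (nu : 'X_{1..n}) (i : 'I_n) : nat :=
  (#|[set j : 'I_n | (j < i) && (nu i < nu j)]| +
   #|[set j : 'I_n | (i < j) && (nu i <= nu j)]|)%N.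

Definition comp_node (K : fieldType) (q t : K) (n : nat) (nu : 'X_{1..n})
    (i : 'I_n) : K :=
  q ^+ nu i * t ^- comp_k nu i.

(* [msize p <= d.+1] says that [p] has total degree at most [d]. *)
Definition is_Estar (K : fieldType) (q t : K) (n : nat) (mu : 'X_{1..n})
    (E : {mpoly K[n]}) : Prop :=
  [/\ (msize E <= (mdeg mu).+1)%N,
      E@_mu = 1
    & forall nu : 'X_{1..n}, (mdeg nu <= mdeg mu)%N -> nu <> mu ->
        E.@[comp_node q t nu] = 0].

Definition estar (K : fieldType) (t : K) (n k : nat) : {mpoly K[n]} :=
  \sum_(S : {set 'I_n} | #|S| == k)
    \prod_(i in S)
      ('X_i - (t ^+ #|[set j in ~: S | (j < i)%N]| / t ^+ n.-1)%:MP).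

Definition estar_seq (K : fieldType) (t : K) (n : nat) (s : seq nat) :
    {mpoly K[n]} :=
  \prod_(k <- s) estar t n k.

(* The entry of index j (from 0) is lambda'_(j+1) = #{i : lambda_i >= j+1}. *)
Definition conj_part (s : seq nat) : seq nat :=
  mkseq (fun j => count (leq j.+1) s) (head 0%N s).

Definition mrev (n : nat) (s : n.-tuple nat) : 'X_{1..n} :=
  Multinom [tuple of rev s].

(* [f] is regular at q = 1 with value [c]; [c] does not depend on the chosen
   fraction. *)
Definition frac_value_at1 (F : fieldType) (f : {fraction {poly F}}) (c : F) :
    Prop :=
  exists u v : {poly F},
    [/\ v.[1] != 0, f = tofrac u / tofrac v & c = u.[1] / v.[1]].

Definition mpoly_value_at1 (F : fieldType) (n : nat)
    (E : {mpoly {fraction {poly F}}[n]}) (e : {mpoly F[n]}) : Prop :=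
  forall m : 'X_{1..n}, frac_value_at1 E@_m e@_m.

(* Main.v *)
Require Import Defs.
From mathcomp Require Import all_boot all_order all_algebra fingroup perm.
From mathcomp Require Import fraction mpoly zify ring.

Set Implicit Arguments.
Unset Strict Implicit.
Unset Printing Implicit Defensive.

Import GRing.Theory.
Local Open Scope ring_scope.

(* Write z = t^(1-n). The Knop-Sahi shift Phi moves the last part of a
   composition to the front and adds 1 to it; on interpolation polynomials it is
   multiplication by x_1 - z after rotating the variables. Adjacent unequal parts
   are exchanged by a linear combination of 1 and the Hecke operator
   T f = ((t x_i - x_(i+1)) s_i f + (1 - t) x_i f) / (x_i - x_(i+1)).
   All these steps are carried out over Q(t)[q], so that they can be followed at
   q = 1. Removing the first column, of length k, from lambda and applying Phi k
   times to the reversed result gives (lambda_k, ..., lambda_1, 0, ..., 0), and at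
   q = 1 the polynomial of the reversed result is multiplied by
   (x_1 - z) ... (x_k - z). Moving the zeros to the front, the coefficients at
   q = 1 depend only on the positions of the zeros; by induction the factor coming
   from the remaining columns is symmetric, hence commutes with the T_i. So the
   new factor is the same as for lambda = (1^k). That factor is symmetric (the
   last step projects onto the s_(n-k)-invariants) and vanishes at every node
   with fewer than k nonzero parts, which determines it up to a scalar: it is
   proportional to e*_k. The coefficient of x^(lambda^rev) in e*_(lambda') is 1,
   which fixes the normalisation. *)

(** * Compositions and their nodes *)

Local Notation "m # s" := [multinom m (fun_of_perm s i) | i < _]
  (at level 40, left associativity, format "m # s").

Section Compositions.
Variable n : nat.
Implicit Types (nu mu : 'X_{1..n}) (i j l : 'I_n) (s : 'S_n).

(** A strict total order on positions: larger parts first and, among equal parts, larger indices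
    first. [comp_k nu j] is the rank of [j], counted from 0. *)
Definition dom nu l j : bool :=
  ((l < j) && (nu j < nu l) || (j < l) && (nu j <= nu l))%N.

Lemma comp_kE nu j : comp_k nu j = #|[set l | dom nu l j]|.
Proof.
rewrite /comp_k -cardsUI.
have -> : [set l : 'I_n | (l < j)%N && (nu j < nu l)%N]
    :&: [set l : 'I_n | (j < l)%N && (nu j <= nu l)%N] = set0.
  by apply/setP=> l; rewrite !inE; case: ltngtP; rewrite ?andbF.
by rewrite cards0 addn0; congr #|pred_of_set _|; apply/setP=> l; rewrite !inE.
Qed.

Lemma dom_irr nu j : dom nu j j = false.
Proof. by rewrite /dom ltnn. Qed.

Lemma comp_k_perm s nu nu' j :
  (forall l, l != j -> dom nu' (s l) (s j) = dom nu l j) ->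
  comp_k nu' (s j) = comp_k nu j.
Proof.
move=> h; rewrite !comp_kE -[RHS](card_imset _ (@perm_inj _ s)).
congr #|pred_of_set _|; apply/setP=> l; rewrite inE.
apply/idP/idP=> [d|/imsetP[l0]]; last first.
  rewrite inE; have [->|ne] := eqVneq l0 j; first by rewrite dom_irr.
  by move=> d ->; rewrite h.
apply/imsetP; exists ((s^-1)%g l); last by rewrite permKV.
rewrite inE -h ?permKV //; apply: contraTneq d => <-.
by rewrite permKV dom_irr.
Qed.

Lemma comp_k_dom nu nu' j :
  (forall l, l != j -> dom nu' l j = dom nu l j) -> comp_k nu' j = comp_k nu j.
Proof.
by move=> h; rewrite -{1}(perm1 j); apply: comp_k_perm => l ne; rewrite !perm1 h.
Qed.

Lemma mperm_tpermK i j nu : nu#(tperm i j)#(tperm i j) = nu.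
Proof. by apply/mnmP => l; rewrite !mnmE tpermK. Qed.

Lemma adj_neq i j : j = i.+1 :> nat -> i != j.
Proof. by move=> ij; rewrite -val_eqE /= ij neq_ltn leqnn. Qed.

Lemma tperm_adj_lt i j l m : j = i.+1 :> nat -> ~~ ((l == i) && (m == j)) ->
  ~~ ((l == j) && (m == i)) -> (tperm i j l < tperm i j m)%N = (l < m)%N.
Proof.
move=> ij h1 h2; have vE (a b : 'I_n) : (a == b) = (a == b :> nat) by [].
case: tpermP => [?|?|/eqP + /eqP +]; case: tpermP => [?|?|/eqP + /eqP +];
  subst; rewrite ?eqxx ?vE in h1 h2 *; lia.
Qed.

(** The exchange alters the index order of the pair [i], [j] only, and there the unequal parts
    decide the comparison. *)
Lemma comp_k_swap i j nu l : j = i.+1 :> nat -> nu i != nu j ->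
  comp_k (nu#(tperm i j)) l = comp_k nu (tperm i j l).
Proof.
move=> ij ne; rewrite -{1}(tpermK i j l); move: (tperm i j l) => {}l.
apply: comp_k_perm => m nm; rewrite /dom !mnmE !tpermK.
have [/andP[/eqP -> /eqP ->]|h1] := boolP ((m == i) && (l == j)).
  by rewrite tpermL tpermR ij; move: ne; lia.
have [/andP[/eqP -> /eqP ->]|h2] := boolP ((m == j) && (l == i)).
  by rewrite tpermL tpermR ij; move: ne; lia.
by rewrite !tperm_adj_lt // 1?andbC // [(_ == i) && _]andbC.
Qed.

(** The tie puts [j] immediately before [i] in the order. At a node this means that t x_i = x_j. *)
Lemma comp_k_eq i j nu : j = i.+1 :> nat -> nu i = nu j ->
  comp_k nu i = (comp_k nu j).+1.
Proof.
move=> ij e; rewrite !comp_kE.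
have -> : [set l | dom nu l i] = j |: [set l | dom nu l j].
  apply/setP=> l; rewrite !inE /dom e.
  have [->|nlj] := eqVneq l j; first by rewrite ij !leqnn orbT.
  have [->|nli] := eqVneq l i; first by rewrite e; lia.
  by move: nlj nli; rewrite -!val_eqE /=; lia.
by rewrite cardsU1 inE dom_irr.
Qed.

Definition rotp m : 'S_m.+1 := perm (@ordS_inj m.+1).

End Compositions.

Lemma rotpE m (i : 'I_m.+1) : rotp m i = (i.+1 %% m.+1)%N :> nat.
Proof. by rewrite permE. Qed.

Lemma rotp_max m : rotp m ord_max = ord0.
Proof. by apply/val_inj; rewrite /= rotpE modnn. Qed.

Lemma rotp_lt m (i : 'I_m.+1) : i != ord_max -> rotp m i = i.+1 :> nat.
Proof.
move=> h; rewrite rotpE modn_small //; have := ltn_ord i.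
by move: h; rewrite -val_eqE /=; lia.
Qed.

(** * The cyclic shift of compositions *)

Section Rotation.
Variable n : nat.
Implicit Types (nu mu : 'X_{1..n.+1}).

(* The map (nu_1, ..., nu_n) |-> (nu_n + 1, nu_1, ..., nu_(n-1)). *)
Definition Phi nu : 'X_{1..n.+1} :=
  [multinom (nu ((rotp n)^-1 i)%g + (i == ord0))%N | i < n.+1].

Lemma PhiE nu i : Phi nu (rotp n i) = (nu i + (i == ord_max))%N.
Proof.
by rewrite mnmE permK -rotp_max (inj_eq (@perm_inj _ _)).
Qed.

(** The last position wins every tie and the first one loses every tie; the added 1 compensates
    exactly for this. *)
Lemma comp_k_Phi nu i : comp_k (Phi nu) (rotp n i) = comp_k nu i.
Proof.
apply: comp_k_perm => l ne; rewrite /dom !PhiE.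
have [e|nl] := eqVneq l ord_max; have [e'|ni] := eqVneq i ord_max.
- by rewrite e e' eqxx in ne.
- have := ltn_ord i; rewrite e rotp_max (rotp_lt ni) /=.
  move: ni; rewrite -val_eqE /=; lia.
- have := ltn_ord l; rewrite e' rotp_max (rotp_lt nl) /=.
  move: nl; rewrite -val_eqE /=; lia.
- by rewrite (rotp_lt ni) (rotp_lt nl) !addn0 !ltnS.
Qed.

Lemma mdeg_Phi nu : mdeg (Phi nu) = (mdeg nu).+1.
Proof.
rewrite !mdegE (reindex_inj (@perm_inj _ (rotp n))) /=.
rewrite (eq_bigr _ (fun i _ => PhiE nu i)) big_split /= -big_mkcond /=.
by rewrite big_pred1_eq addn1.
Qed.

Lemma Phi_surj mu : (0 < mu ord0)%N -> exists nu, mu = Phi nu.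
Proof.
move=> h; exists [multinom (mu (rotp n i) - (i == ord_max))%N | i < n.+1].
apply/mnmP=> i; rewrite -(permKV (rotp n) i) PhiE mnmE subnK //.
by case: eqP => // ->; rewrite rotp_max.
Qed.

End Rotation.

Section Zeros.
Variable n : nat.
Implicit Types (nu mu : 'X_{1..n}) (i j l : 'I_n).

Definition zeros nu (m : nat) : nat := #|[set l : 'I_n | (l < m)%N && (nu l == 0%N)]|.

(** Every other position either dominates [i] or holds a zero to the left of [i]. *)
Lemma comp_k_zero nu i : nu i = 0%N -> (comp_k nu i + zeros nu i).+1 = n.
Proof.
move=> z; rewrite comp_kE /zeros -cardsUI.
have -> : [set l | dom nu l i] :&: [set l : 'I_n | (l < i)%N && (nu l == 0%N)] = set0.
  apply/setP=> l; rewrite !inE /dom z; lia.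
have -> : [set l | dom nu l i] :|: [set l : 'I_n | (l < i)%N && (nu l == 0%N)] = [set~ i].
  apply/setP=> l; rewrite !inE /dom z -val_eqE /=; lia.
by rewrite cards0 addn0 cardsC1 card_ord prednK // (leq_trans _ (ltn_ord i)).
Qed.

Lemma zerosS nu i : zeros nu i.+1 = (zeros nu i + (nu i == 0%N))%N.
Proof.
rewrite /zeros; have [z|nz] := boolP (nu i == 0%N).
  rewrite addn1 (_ : [set l : 'I_n | _] =
     i |: [set l : 'I_n | (l < i)%N && (nu l == 0%N)]).
    by rewrite cardsU1 !inE ltnn.
  apply/setP=> l; rewrite !inE -val_eqE /= ltnS leq_eqVlt.
  by have [/val_inj ->|ne] := eqVneq (val l) (val i).
rewrite addn0; congr #|pred_of_set _|; apply/setP=> l; rewrite !inE ltnS leq_eqVlt.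
by have [/val_inj ->|ne] := eqVneq (val l) (val i); rewrite //= (negbTE nz) ?andbF.
Qed.

End Zeros.

Section Tail.
Variable n : nat.
Implicit Types (nu : 'X_{1..n}).

(** The new zero is last in the order and leaves the other ranks alone, so the node of [zcons nu] is
    the node of [nu] with t^(-n) put in front. *)
Definition zcons nu : 'X_{1..n.+1} := 
  [multinom (if unlift ord0 i is Some j then nu j else 0%N) | i < n.+1].

Lemma zcons0 nu : zcons nu ord0 = 0%N.
Proof. by rewrite mnmE unlift_none. Qed.

Lemma zconsS nu i : zcons nu (lift ord0 i) = nu i.
Proof. by rewrite mnmE liftK. Qed.

Lemma mdeg_zcons nu : mdeg (zcons nu) = mdeg nu.
Proof.
rewrite !mdegE big_ord_recl zcons0 add0n.
by apply: eq_bigr => i _; rewrite zconsS.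
Qed.

Lemma comp_k_zcons0 nu : comp_k (zcons nu) ord0 = n.
Proof.
have := comp_k_zero (zcons0 nu).
by rewrite /zeros (_ : [set _ | _] = set0) ?cards0 ?addn0 => [[]|]; last exact/setP.
Qed.

Lemma comp_k_zconsS nu i : comp_k (zcons nu) (lift ord0 i) = comp_k nu i.
Proof.
rewrite !comp_kE -[RHS](card_imset _ (@lift_inj _ ord0)).
congr #|pred_of_set _|; apply/setP=> l; rewrite !inE.
have liftE (a : 'I_n) : lift ord0 a = a.+1 :> nat by [].
case: (unliftP ord0 l) => [m ->|->]; last first.
  rewrite (_ : dom _ _ _ = false); last by rewrite /dom zconsS zcons0 ltn0 andbF.
  apply/esym/negbTE/imsetP.
  by case=> x _ e; have := neq_lift ord0 x; rewrite -e eqxx.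
by rewrite mem_imset ?inE /dom ?zconsS ?liftE ?ltnS //; apply: lift_inj.
Qed.

End Tail.

(** * Multivariate polynomials and injectivity of the interpolation problem *)

Section Polynomials.
Variable n : nat.

Lemma mpoly_ringind (R : comNzRingType) (P : {mpoly R[n]} -> Prop) :
  (forall c, P c%:MP) -> (forall i, P 'X_i) ->
  (forall p r, P p -> P r -> P (p + r)) ->
  (forall p r, P p -> P r -> P (p * r)) -> forall p, P p.
Proof.
move=> hC hX hD hM; elim/mpolyind => [|c m p _ _ hp].
  by rewrite -mpolyC0; apply: hC.
apply: hD => //; rewrite -mul_mpolyC; apply: (hM); first exact: hC.
rewrite mpolyXE_id; apply: (big_ind P) => [|p1 p2|i _].
- by rewrite -mpolyC1; apply: hC.
- exact: hM.
elim: (m i) => [|k ih]; first by rewrite expr0 -mpolyC1; apply: hC.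
by rewrite exprS; apply: hM.
Qed.

(** Products are handled by FG - sF sG = (F - sF) G + sF (G - sG), with s for [sig]. This serves for
    division by x_1 - z and by x_i - x_j. *)
Lemma sub_rmorph_dvd (R : comNzRingType)
    (sig : {rmorphism {mpoly R[n]} -> {mpoly R[n]}}) (del : {mpoly R[n]}) :
  (forall c, sig c%:MP = c%:MP) ->
  (forall i, exists D, 'X_i - sig 'X_i = del * D) ->
  forall F, exists D, F - sig F = del * D.
Proof.
move=> hC hX; apply: mpoly_ringind => [c|//|p r [D e] [D' e']|p r [D e] [D' e']].
- by exists 0; rewrite hC subrr mulr0.
- by exists (D + D'); rewrite mulrDr -e -e' rmorphD /=; ring.
- exists (D * r + sig p * D'); rewrite mulrDr mulrA -e mulrCA -e' rmorphM /=; ring.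
Qed.

Lemma msizeM_leq (R : nzRingType) (p r : {mpoly R[n]}) a b :
  (msize p <= a.+1 -> msize r <= b.+1 -> msize (p * r) <= (a + b).+1)%N.
Proof.
have [->|nz_p] := eqVneq p 0; first by rewrite mul0r msize0.
have [->|nz_r] := eqVneq r 0; first by rewrite mulr0 msize0.
have [->|nz_pr] := eqVneq (p * r) 0; first by rewrite msize0.
rewrite -!mlead_deg // !ltnS => hp hr.
by apply: (leq_trans (lemc_mdeg (mleadM_le p r))); rewrite mdegD leq_add.
Qed.

Lemma msizeXU (R : nzRingType) i : msize ('X_i : {mpoly R[n]}) = 2%N.
Proof. by rewrite msizeX mdeg1. Qed.

Lemma msizeC_leq (R : nzRingType) (c : R) : (msize (c%:MP : {mpoly R[n]}) <= 1)%N.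
Proof. by rewrite msizeC leq_b1. Qed.

Lemma msizeB_leq (R : nzRingType) (p r : {mpoly R[n]}) a :
  (msize p <= a -> msize r <= a -> msize (p - r) <= a)%N.
Proof.
by move=> hp hr; apply: (leq_trans (msizeD_le _ _)); rewrite msizeN geq_max hp hr.
Qed.

Lemma msize_prod_leq (R : nzRingType) (I : Type) (s : seq I) (P : pred I)
    (f : I -> {mpoly R[n]}) (d : I -> nat) :
  (forall i, P i -> msize (f i) <= (d i).+1)%N ->
  (msize (\prod_(i <- s | P i) f i) <= (\sum_(i <- s | P i) d i).+1)%N.
Proof.
move=> h; elim/big_rec2: _ => [|i k p Pi hp]; first by rewrite msize1.
by apply: msizeM_leq => //; apply: h.
Qed.

Lemma msize_exp_leq (R : nzRingType) (p : {mpoly R[n]}) a k :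
  (msize p <= a.+1 -> msize (p ^+ k) <= (k * a).+1)%N.
Proof.
move=> h; elim: k => [|k ih]; first by rewrite expr0 msize1.
by rewrite exprS mulSn; apply: msizeM_leq.
Qed.

Lemma msize_mul_linear (R : idomainType) (L D : {mpoly R[n]}) i :
  L@_U_(i) != 0 -> D != 0 -> (msize D < msize (L * D))%N.
Proof.
move=> hL hD; have := hL; rewrite -mcoeff_msupp => /msize_mdeg_lt.
rewrite mdeg1 => h; rewrite msizeM //; first by lia.
by apply: contraNneq hL => ->; rewrite mcoeff0.
Qed.

Lemma meval_msym (R : comNzRingType) (s : 'S_n) (p : {mpoly R[n]}) v :
  (msym s p).@[v] = p.@[v \o s].
Proof.
elim/mpoly_ringind: p => [c|i|p r hp hr|p r hp hr].
- by rewrite /msym mmapC !mevalC.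
- by rewrite /msym mmapX mmap1U !mevalXU.
- by rewrite rmorphD !mevalD hp hr.
- by rewrite rmorphM !mevalM hp hr.
Qed.

Lemma msymC (R : nzRingType) (s : 'S_n) (c : R) : msym s (c%:MP_[n]) = c%:MP.
Proof. by rewrite /msym mmapC. Qed.

Lemma msymXU (R : nzRingType) (s : 'S_n) i : msym s ('X_i : {mpoly R[n]}) = 'X_(s i).
Proof. by rewrite /msym mmapX mmap1U. Qed.

Lemma msize_msym (R : nzRingType) (s : 'S_n) (p : {mpoly R[n]}) :
  (msize (msym s p) <= msize p)%N.
Proof.
rewrite msizeE; apply/bigmax_leqP_seq => m + _.
rewrite mcoeff_msupp mcoeff_sym -mcoeff_msupp => /msize_mdeg_lt.
by rewrite mdeg_mperm.
Qed.

Lemma map_msym (R S : nzRingType) (f : {rmorphism R -> S}) (s : 'S_n) (p : {mpoly R[n]}) :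
  map_mpoly f (msym s p) = msym s (map_mpoly f p).
Proof. by apply/mpolyP => m; rewrite mcoeff_map_mpoly !mcoeff_sym mcoeff_map_mpoly. Qed.

Lemma msize_map_mpoly (R S : nzRingType) (f : {rmorphism R -> S}) (p : {mpoly R[n]}) :
  (msize (map_mpoly f p) <= msize p)%N.
Proof.
rewrite msizeE; apply/bigmax_leqP_seq => m + _.
rewrite mcoeff_msupp mcoeff_map_mpoly => h; apply: msize_mdeg_lt.
by rewrite mcoeff_msupp; apply: contraNneq h => ->; rewrite raddf0.
Qed.

Lemma meval_map_mpoly (R S : comNzRingType) (f : {rmorphism R -> S}) (p : {mpoly R[n]}) v :
  (map_mpoly f p).@[f \o v] = f p.@[v].
Proof.
elim/mpoly_ringind: p => [c|i|p r hp hr|p r hp hr].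
- by rewrite map_mpolyC !mevalC.
- by rewrite map_mpolyX !mevalXU.
- by rewrite rmorphD !mevalD hp hr rmorphD.
- by rewrite rmorphM !mevalM hp hr rmorphM.
Qed.

Lemma meval_comb (R : comNzRingType) (c d : R) (p r : {mpoly R[n]}) v :
  (c *: p - d *: r).@[v] = c * p.@[v] - d * r.@[v].
Proof. by rewrite mevalB !mevalZ. Qed.

Lemma mcoeff_scale_eq (R : nzRingType) (a b : R) (p r : {mpoly R[n]}) m :
  a *: p = b *: r -> a * p@_m = b * r@_m.
Proof. by move/(congr1 (mcoeff m)); rewrite !mcoeffZ. Qed.

Lemma comp_mpoly_comp (R : comNzRingType) k l (p : {mpoly R[n]})
    (u : n.-tuple {mpoly R[k]}) (v : k.-tuple {mpoly R[l]}) :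
  (p \mPo u) \mPo v = p \mPo [tuple (tnth u i) \mPo v | i < n].
Proof.
elim/mpoly_ringind: p => [c|i|p r hp hr|p r hp hr].
- by rewrite !comp_mpolyC.
- by rewrite !comp_mpolyXU -!tnth_nth tnth_mktuple.
- by rewrite !rmorphD /= hp hr.
- by rewrite !rmorphM /= hp hr.
Qed.

End Polynomials.

Lemma msize_comp_mpoly (R : comNzRingType) n k (p : {mpoly R[n]})
    (u : n.-tuple {mpoly R[k]}) :
  (forall i, msize (tnth u i) <= 2)%N -> (msize (p \mPo u) <= msize p)%N.
Proof.
move=> hu; rewrite comp_mpolyEX big_seq.
apply: (leq_trans (msize_sum _ _ _)); apply/bigmax_leqP_seq => m mp _.
apply: (leq_trans (msizeZ_le _ _)); rewrite comp_mpolyX.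
apply: (leq_trans _ (msize_mdeg_lt mp)); rewrite mdegE.
apply: msize_prod_leq => i _; rewrite -[X in (_ <= X.+1)%N]muln1.
exact: msize_exp_leq.
Qed.

(** * Injectivity of evaluation at the nodes *)

Section Injectivity.
Variables (K : fieldType) (q t : K).
Hypothesis q_neq0 : q != 0.
Hypothesis generic : forall a k l, q ^+ a * t ^- k = t ^- l -> a = 0%N.

Lemma comp_node_zcons n (nu : 'X_{1..n}) i :
  comp_node q t (zcons nu) (lift ord0 i) = comp_node q t nu i.
Proof. by rewrite /comp_node zconsS comp_k_zconsS. Qed.

Lemma comp_node_zcons0 n (nu : 'X_{1..n}) :
  comp_node q t (zcons nu) ord0 = t ^- n.
Proof. by rewrite /comp_node zcons0 comp_k_zcons0 mul1r. Qed.

Lemma comp_node_Phi n (nu : 'X_{1..n.+1}) i :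
  comp_node q t (Phi nu) (rotp n i) = q ^+ (i == ord_max) * comp_node q t nu i.
Proof. by rewrite /comp_node PhiE comp_k_Phi addnC exprD mulrA. Qed.

(** Induction on the number of variables, then on the degree bound. Compositions with a zero in
    front force divisibility by x_1 - t^(-n); those of the form [Phi nu] show that the quotient,
    after rotating and rescaling the variables, vanishes at the nodes of smaller degree. *)
Theorem comp_node_vanish n d (f : {mpoly K[n]}) : (msize f <= d)%N ->
  (forall nu : 'X_{1..n}, (mdeg nu < d)%N -> f.@[comp_node q t nu] = 0) -> f = 0.
Proof.
elim: n => [|n IHn] in d f *.
  case: d => [|d] hf h0; first by apply/eqP; rewrite -msize_poly_eq0 -leqn0.
  have f1 : (msize f <= 1)%N.
    by rewrite msizeE; apply/bigmax_leqP_seq => m _ _; rewrite mdegE big_ord0.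
  have := h0 0%MM; rewrite mdeg0 (msize1_polyC f1) mevalC => -> //.
elim: d f => [|d IHd] f hf h0; first by apply/eqP; rewrite -msize_poly_eq0 -leqn0.
pose z := t ^- n.
pose u := [tuple if unlift ord0 i is Some j then 'X_j else (z%:MP_[n] : {mpoly K[n]}) | i < n.+1].
pose v := [tuple ('X_(lift ord0 i) : {mpoly K[n.+1]}) | i < n].
have f00 : f \mPo u = 0.
  apply: (IHn d.+1).
    apply: leq_trans hf; apply: msize_comp_mpoly => i; rewrite tnth_mktuple.
    case: unlift => [j|]; first by rewrite msizeXU.
    by apply: leq_trans (msizeC_leq _ _) _.
  move=> nu hnu; rewrite comp_mpoly_meval -[RHS](h0 (zcons nu)) ?mdeg_zcons //.
  apply: meval_eq => i; rewrite tnth_mktuple.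
  case: unliftP => [j ->|->]; first by rewrite mevalXU comp_node_zcons.
  by rewrite mevalC comp_node_zcons0.
(* [sig] is the substitution x_1 = z, as in [u], but kept in n + 1 variables so that [f - sig f] is
   a multiple of x_1 - z. *)
pose sig := comp_mpoly [tuple (if i == ord0 then z%:MP else 'X_i : {mpoly K[n.+1]}) | i < n.+1].
have sigf : sig f = 0.
  transitivity ((f \mPo u) \mPo v); last by rewrite f00 comp_mpoly0.
  rewrite comp_mpoly_comp /sig; congr (comp_mpoly _ f); apply: eq_from_tnth => i.
  rewrite !tnth_mktuple; case: unliftP => [j ->|->].
    by rewrite comp_mpolyXU -tnth_nth tnth_mktuple eq_sym (negbTE (neq_lift _ _)).
  by rewrite comp_mpolyC eqxx.
have [||D] := @sub_rmorph_dvd _ _ sig ('X_ord0 - z%:MP) _ _ f.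
- by move=> c; exact: comp_mpolyC.
- move=> i; rewrite /sig /= comp_mpolyXU -tnth_nth tnth_mktuple.
  case: eqP => [->|_]; first by exists 1; rewrite mulr1.
  by exists 0; rewrite subrr mulr0.
rewrite [X in f - X]sigf subr0 => fE; have [D0|D0] := eqVneq D 0; first by rewrite fE D0 mulr0.
have hD : (msize D <= d)%N.
  rewrite -ltnS; apply: leq_trans hf; rewrite fE.
  apply: (@msize_mul_linear _ _ _ _ ord0) => //.
  rewrite mcoeffB mcoeffXU eqxx mcoeffC mnm1_eq0 mulr0 subr0; exact: oner_neq0.
(* Substituting [w] turns evaluation at the node of [nu] into evaluation at the node of [Phi nu];
   [w'] is the inverse substitution. *)
pose w := [tuple (q ^+ (i == ord0)) *: ('X_((rotp n)^-1 i)%g : {mpoly K[n.+1]}) | i < n.+1].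
pose w' := [tuple (q ^- (i == ord_max)) *: ('X_(rotp n i) : {mpoly K[n.+1]}) | i < n.+1].
have Dw : D \mPo w = 0.
  apply: IHd => [|nu hnu].
    apply: leq_trans hD; apply: msize_comp_mpoly => i; rewrite tnth_mktuple.
    by apply: (leq_trans (msizeZ_le _ _)); rewrite msizeXU.
  rewrite comp_mpoly_meval (@meval_eq _ _ _ (comp_node q t (Phi nu))) => [|i].
    have := h0 (Phi nu); rewrite mdeg_Phi ltnS => /(_ hnu)/eqP.
    rewrite fE mevalM mulf_eq0 mevalB mevalXU mevalC subr_eq0 => /orP[/eqP|/eqP //].
    (* The first coordinate at [Phi nu] carries a positive power of q, so it differs from z. *)
    by rewrite -{1}rotp_max /comp_node PhiE eqxx addn1 => /generic.
  rewrite tnth_mktuple mevalZ mevalXU -{3}(permKV (rotp n) i) comp_node_Phi.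
  by rewrite -[in RHS](inj_eq (@perm_inj _ (rotp n))) permKV rotp_max.
suff DE : D = (D \mPo w) \mPo w' by rewrite fE DE Dw comp_mpoly0 mulr0.
rewrite comp_mpoly_comp -[LHS]comp_mpoly_id; congr (comp_mpoly _ D).
apply: eq_from_tnth => i; rewrite !tnth_mktuple comp_mpolyZ comp_mpolyXU -tnth_nth.
rewrite tnth_mktuple permKV -[in q ^- _](inj_eq (@perm_inj _ (rotp n))) permKV rotp_max.
by rewrite scalerA divff ?scale1r // expf_neq0.
Qed.

(** Up to degree |mu|, both polynomials vanish at all nodes but that of [mu], so a combination that
    also vanishes there is zero. Comparing coefficients of x^mu then shows that the two values at
    this node agree. *)
Lemma is_Estar_unique n (mu : 'X_{1..n}) (E E' : {mpoly K[n]}) :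
  is_Estar q t mu E -> is_Estar q t mu E' -> E = E'.
Proof.
move=> [zE cE vE] [zE' cE' vE'].
have dep (D : {mpoly K[n]}) : (msize D <= (mdeg mu).+1)%N ->
    (forall nu : 'X_{1..n}, (mdeg nu <= mdeg mu)%N -> nu <> mu ->
       D.@[comp_node q t nu] = 0) ->
    D.@[comp_node q t mu] = 0 -> D = 0.
  move=> zD vD vm; apply: (comp_node_vanish zD) => nu hnu.
  by have [->|/eqP ne] := eqVneq nu mu; [exact: vm|exact: vD].
pose a := E.@[comp_node q t mu]; pose b := E'.@[comp_node q t mu].
have prop : b *: E - a *: E' = 0.
  apply: dep.
  - by apply: msizeB_leq; apply: leq_trans (msizeZ_le _ _) _.
  - by move=> nu hnu ne; rewrite meval_comb vE // vE' // !mulr0 subrr.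
  - by rewrite meval_comb mulrC subrr.
have ab : b = a.
  have := congr1 (mcoeff mu) prop.
  by rewrite mcoeffB !mcoeffZ cE cE' !mulr1 mcoeff0 => /eqP; rewrite subr_eq0 => /eqP.
have an0 : a != 0.
  apply/eqP => va; have E0 : E = 0 by apply: dep.
  by have := cE; rewrite E0 mcoeff0 => /eqP; rewrite eq_sym oner_eq0.
move: prop; rewrite ab -scalerBr => /eqP; rewrite scaler_eq0 (negbTE an0) /= subr_eq0.
by move/eqP.
Qed.

End Injectivity.

(** * Hecke operators and the shift on interpolation polynomials *)

Section DividedDifference.
Variables (n : nat) (i j : 'I_n).
Hypothesis ij : i != j.

(* [G] is the image of [F] under the Demazure-Lusztig operator
   F |-> ((t x_i - x_j) s F + (1 - t) x_i F) / (x_i - x_j), s exchanging x_i and x_j. *)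
Definition Hecke (R : comNzRingType) (t : R) (F G : {mpoly R[n]}) : Prop :=
  ('X_i - 'X_j) * G
    = (t *: 'X_i - 'X_j) * msym (tperm i j) F + (1 - t) *: 'X_i * F.

Lemma mcoeff_XsubX (R : comNzRingType) : ('X_i - 'X_j : {mpoly R[n]})@_U_(i) = 1.
Proof. by rewrite mcoeffB !mcoeffXU eqxx eq_sym (negbTE ij) subr0. Qed.

Lemma XsubX_neq0 (R : comNzRingType) : 'X_i - 'X_j != 0 :> {mpoly R[n]}.
Proof.
apply/eqP => /(congr1 (mcoeff U_(i))).
by rewrite mcoeff_XsubX mcoeff0 => /eqP; rewrite oner_eq0.
Qed.

(** The operator equals sF + (1 - t) x_i (F - sF) / (x_i - x_j), and x_i - x_j divides F - sF. *)
Lemma Hecke_exists (R : comNzRingType) (t : R) F : exists G, Hecke t F G.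
Proof.
have [||D e] := @sub_rmorph_dvd _ _ (msym (tperm i j)) ('X_i - 'X_j) _ _ F.
- by move=> c; exact: msymC.
- move=> l /=; rewrite msymXU; case: tpermP => [->|->|_ _].
  + by exists 1; rewrite mulr1.
  + by exists (-1); rewrite mulrN1 opprB.
  + by exists 0; rewrite subrr mulr0.
exists (msym (tperm i j) F + (1 - t) *: 'X_i * D).
have eF : F = msym (tperm i j) F + ('X_i - 'X_j) * D by rewrite -e; ring.
rewrite /Hecke [in (1 - t) *: 'X_i * F]eF -!mul_mpolyC rmorphB rmorph1; ring.
Qed.

Lemma Hecke_msize (R : idomainType) (t : R) F G :
  Hecke t F G -> (msize G <= msize F)%N.
Proof.
move=> e; have [->|G0] := eqVneq G 0; first by rewrite msize0.
have := @msize_mul_linear _ _ ('X_i - 'X_j) G i; rewrite mcoeff_XsubX oner_neq0 e.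
move=> /(_ isT G0) h; rewrite -ltnS; apply: (leq_trans h).
have [F0|F0] := eqVneq F 0; first by rewrite F0 rmorph0 !mulr0 addr0 msize0.
apply: (leq_trans (msizeD_le _ _)); rewrite geq_max.
have hF : msize F = (msize F).-1.+1 by rewrite prednK // lt0n msize_poly_eq0.
rewrite hF -[_.+2]/(1 + (msize F).-1).+1%N.
rewrite !msizeM_leq // -?hF ?msize_msym //; last by rewrite msizeB_leq ?msizeXU //;
  rewrite (leq_trans (msizeZ_le _ _)) ?msizeXU.
by rewrite (leq_trans (msizeZ_le _ _)) ?msizeXU.
Qed.

Lemma Hecke_map (R S : comNzRingType) (f : {rmorphism R -> S}) (t : R) F G :
  Hecke t F G -> Hecke (f t) (map_mpoly f F) (map_mpoly f G).
Proof.
move/(congr1 (map_mpoly f)).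
rewrite rmorphD !rmorphM !rmorphB /= !map_mpolyZ !map_mpolyX map_msym.
by rewrite rmorphB rmorph1.
Qed.

Lemma Hecke_eval (R : comNzRingType) (t : R) F G v : Hecke t F G ->
  (v i - v j) * G.@[v]
    = (t * v i - v j) * F.@[v \o tperm i j] + (1 - t) * v i * F.@[v].
Proof.
move/(congr1 (meval v)).
by rewrite mevalD !mevalM !mevalB !mevalZ !mevalXU meval_msym.
Qed.

Lemma Hecke_mull (R : comNzRingType) (t : R) f F G : msym (tperm i j) f = f ->
  Hecke t F G -> Hecke t (f * F) (f * G).
Proof.
move=> sf e; rewrite /Hecke msymM sf mulrCA e mulrDr.
by congr (_ + _); rewrite mulrCA.
Qed.

End DividedDifference.

(** * Interpolation with coefficients in F[q] *)

Section Nodes.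
Variables (F : fieldType) (t : F).
Hypothesis t_neq0 : t != 0.
Hypothesis t_inj : forall k l : nat, t ^- k = t ^- l -> k = l.
Local Notation A := {poly F}.

(* The nodes of the context, with q the polynomial variable. *)
Definition anode n (nu : 'X_{1..n}) (i : 'I_n) : A :=
  t ^- comp_k nu i *: 'X^(nu i).

Lemma tV_neq0 k : t ^- k != 0.
Proof. by rewrite invr_eq0 expf_neq0. Qed.

Lemma scaleXn_inj (a b k l : nat) :
  t ^- k *: 'X^a = t ^- l *: 'X^b :> A -> a = b /\ k = l.
Proof.
move=> e; have := congr1 (fun p : A => size p) e.
rewrite !size_scale ?tV_neq0 // !size_polyXn => -[ab]; split=> //.
have := congr1 (fun p : A => lead_coef p) e.
by rewrite !lead_coefZ !lead_coefXn !mulr1 => /t_inj.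
Qed.

Lemma tofrac_scaleXn a k :
  tofrac (t ^- k *: 'X^a : A) = tofrac 'X ^+ a * tofrac t%:P ^- k.
Proof.
rewrite -mul_polyC rmorphM /= rmorphXn /= mulrC; congr (_ * _).
have e : tofrac (t ^- k)%:P * tofrac t%:P ^+ k = 1.
  by rewrite -rmorphXn -rmorphM /= -polyC_exp -polyCM mulVf ?expf_neq0 ?rmorph1.
have h : tofrac t%:P ^+ k != 0.
  by apply: contraTneq (oner_neq0 {fraction A}) => h0; rewrite -e h0 mulr0 eqxx.
by apply: (mulIf h); rewrite e mulVf.
Qed.

Lemma tofrac_anode n (nu : 'X_{1..n}) i :
  tofrac (anode nu i) = comp_node (tofrac 'X) (tofrac t%:P) nu i.
Proof. exact: tofrac_scaleXn. Qed.

Lemma tofrac_generic a k l :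
  tofrac ('X : A) ^+ a * tofrac t%:P ^- k = tofrac t%:P ^- l -> a = 0%N.
Proof.
rewrite -tofrac_scaleXn -[RHS]mul1r -(expr0 (tofrac 'X)) -tofrac_scaleXn.
by move/eqP; rewrite tofrac_eq => /eqP/scaleXn_inj[].
Qed.

Lemma comp_node_vanish_frac n d (E : {mpoly {fraction A}[n]}) : (msize E <= d)%N ->
  (forall nu : 'X_{1..n}, (mdeg nu < d)%N ->
     E.@[comp_node (tofrac 'X) (tofrac t%:P) nu] = 0) -> E = 0.
Proof.
apply: comp_node_vanish; last exact: tofrac_generic.
by rewrite tofrac_eq0 polyX_eq0.
Qed.

Lemma meval_tofrac n (P : {mpoly A[n]}) nu :
  (map_mpoly (@tofrac A) P).@[comp_node (tofrac 'X) (tofrac t%:P) nu]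
    = tofrac P.@[anode nu].
Proof.
rewrite -(@meval_map_mpoly _ _ _ (@tofrac A)); apply: meval_eq => i.
by rewrite -tofrac_anode.
Qed.

Lemma anode_vanish n d (P : {mpoly A[n]}) : (msize P <= d)%N ->
  (forall nu : 'X_{1..n}, (mdeg nu < d)%N -> P.@[anode nu] = 0) -> P = 0.
Proof.
move=> hP h; have e : map_mpoly (@tofrac A) P = 0.
  apply: (@comp_node_vanish_frac _ d).
    by apply: leq_trans (msize_map_mpoly _ _) hP.
  by move=> nu hnu; rewrite meval_tofrac h ?rmorph0.
apply/mpolyP => m; have := congr1 (mcoeff m) e.
by rewrite mcoeff_map_mpoly !mcoeff0 => /eqP; rewrite tofrac_eq0 => /eqP.
Qed.

(** Equal powers of q would mean equal parts, and then [comp_k_eq] makes the powers of t differ.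
    Hence x_i - x_j can be cancelled at every node. *)
Lemma anode_adj_neq n (i j : 'I_n) (nu : 'X_{1..n}) : j = i.+1 :> nat ->
  anode nu i != anode nu j.
Proof.
move=> ij; apply/eqP => /scaleXn_inj[e]; rewrite (comp_k_eq ij e).
by move/eqP; rewrite eqn_leq ltnn.
Qed.

Lemma anode_swap n (i j : 'I_n) (nu : 'X_{1..n}) : j = i.+1 :> nat ->
  nu i != nu j -> anode nu \o tperm i j =1 anode (nu#(tperm i j)).
Proof. by move=> ij ne l; rewrite /= /anode mnmE comp_k_swap. Qed.

(** The conditions on the interpolation polynomial without its normalisation. Dropping that avoids
    denominators in q, so that q = 1 can be substituted throughout. *)
Definition Good n (mu : 'X_{1..n}) (P : {mpoly A[n]}) : Prop :=
  (msize P <= (mdeg mu).+1)%N /\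
  forall nu : 'X_{1..n}, (mdeg nu <= mdeg mu)%N -> nu <> mu -> P.@[anode nu] = 0.

Local Notation at1 := (map_mpoly (horner_eval (1 : F))).

Lemma at1Z n (c : A) (P : {mpoly A[n]}) : at1 (c *: P) = c.[1] *: at1 P.
Proof. exact: map_mpolyZ. Qed.

(** [H] is q^d P with x_l replaced by x_l / q; the degree bound on [P] ensures that q^d clears the
    denominators. *)
Lemma rescale n (l : 'I_n) d (P : {mpoly A[n]}) : (msize P <= d.+1)%N ->
  exists H, [/\ (msize H <= d.+1)%N, at1 H = at1 P
    & forall v v', v' l = 'X * v l -> (forall i, i != l -> v' i = v i) ->
      H.@[v'] = 'X^d * P.@[v]].
Proof.
move=> hP; exists (\sum_(m <- msupp P) (P@_m * 'X^(d - m l)) *: 'X_[m]); split.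
- rewrite big_seq; apply: (leq_trans (msize_sum _ _ _)).
  apply/bigmax_leqP_seq => m mp _; apply: (leq_trans (msizeZ_le _ _)).
  by rewrite msizeX; apply: leq_trans (msize_mdeg_lt mp) hP.
- rewrite [in RHS](mpolyE P) !raddf_sum /=; apply: eq_bigr => m _.
  by rewrite !at1Z hornerM hornerXn expr1n mulr1.
move=> v v' hl hv; rewrite [in RHS](mpolyE P) !raddf_sum mulr_sumr.
rewrite !big_seq; apply: eq_bigr => m mp.
have hm : (m l <= d)%N.
  have := leq_trans (msize_mdeg_lt mp) hP; rewrite ltnS; apply: leq_trans.
  by rewrite mdegE (bigD1 l) //= leq_addr.
rewrite /= !mevalZ !mevalX (bigD1 l) //= [in RHS](bigD1 l) //= hl exprMn.
rewrite (eq_bigr (fun i => v i ^+ m i)) => [|i /hv -> //].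
by rewrite -[in RHS](subnK hm) exprD; ring.
Qed.

(** If [nu] starts with 0, the first coordinate of its node is t^(-n) and the linear factor
    vanishes. Otherwise [nu] is some [Phi nu'], and the rotated rescaled polynomial gives a power of
    q times the value of [P] at the node of [nu']. *)
Lemma Good_Phi n (mu : 'X_{1..n.+1}) P : Good mu P -> exists Q,
  Good (Phi mu) Q /\ at1 Q = ('X_ord0 - (t ^- n)%:MP) * msym (rotp n) (at1 P).
Proof.
move=> [hP h0]; have [H [hH e ev]] := rescale ord_max hP.
exists (('X_ord0 - (t ^- n)%:P%:MP) * msym (rotp n) H); split; last first.
  rewrite rmorphM rmorphB /= map_mpolyX map_mpolyC map_msym e; congr ((_ - _%:MP) * _).
  exact: hornerC.
split; rewrite mdeg_Phi.
  rewrite -[_.+2]/(1 + mdeg mu).+1%N; apply: msizeM_leq.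
    by apply: msizeB_leq; rewrite ?msizeXU //; apply: leq_trans (msizeC_leq _ _) _.
  exact: leq_trans (msize_msym _ _) hH.
move=> nu hnu ne; rewrite mevalM mevalB mevalXU mevalC meval_msym.
have [z|nz] := posnP (nu ord0).
  have := comp_k_zero z; rewrite /zeros (_ : [set _ | _] = set0) ?cards0 ?addn0.
    by move=> [k]; rewrite /anode z k expr0 alg_polyC subrr mul0r.
  exact/setP.
have [nu' e'] := Phi_surj nz; rewrite e' (ev (anode nu')).
- rewrite h0 ?mulr0 //; first by rewrite -ltnS -mdeg_Phi -e'.
  by move=> e2; apply: ne; rewrite e' e2.
- by rewrite /= /anode PhiE comp_k_Phi eqxx addn1 exprS -scalerAr.
- by move=> i /negbTE ne'; rewrite /= /anode PhiE comp_k_Phi ne' addn0.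
Qed.

Lemma anode_eq_adj n (i j : 'I_n) (nu : 'X_{1..n}) : j = i.+1 :> nat ->
  nu i = nu j -> t *: anode nu i = anode nu j.
Proof.
move=> ij e; rewrite /anode (comp_k_eq ij e) e scalerA; congr (_ *: _).
by rewrite exprS invfM mulrA divff ?mul1r.
Qed.

(** Where the parts [i] and [j] are equal, the factor t x_i - x_j of the operator vanishes.
    Elsewhere only the values of [P] at [nu] and at its exchange enter, so only [mu] and its
    exchange can survive; the coefficients are chosen to cancel the value at [mu]. *)
Lemma Good_swap n (i j : 'I_n) (mu : 'X_{1..n}) P Q : j = i.+1 :> nat ->
  mu i != mu j -> Good mu P -> Hecke i j t%:P P Q ->
  Good (mu#(tperm i j))
    ((anode mu i - anode mu j) *: Q - ((1 - t%:P) * anode mu i) *: P).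
Proof.
move=> ij ne [hP h0] hQ; split.
  rewrite mdeg_mperm; apply: msizeB_leq; apply: (leq_trans (msizeZ_le _ _)) => //.
  by apply: leq_trans hP; apply: Hecke_msize hQ; apply: adj_neq.
move=> nu; rewrite mdeg_mperm => hnu nnu; rewrite mevalB !mevalZ.
have xy := anode_adj_neq nu ij.
have xy' : anode nu i - anode nu j != 0 by rewrite subr_eq0.
apply: (mulfI xy'); rewrite mulr0 mulrBr mulrCA (Hecke_eval _ hQ).
have [e|ne'] := eqVneq (nu i) (nu j).
  rewrite mul_polyC (anode_eq_adj ij e) subrr mul0r h0 ?mulr0 ?addr0 ?mulr0 ?subr0 //.
  by move=> e'; rewrite e' in e; rewrite e eqxx in ne.
rewrite (meval_eq _ (anode_swap ij ne')) [in P.@[anode (_#_)]]h0; first last.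
- by move=> e; apply: nnu; rewrite -e mperm_tpermK.
- by rewrite mdeg_mperm.
have [->|/eqP nu_mu] := eqVneq nu mu; first by ring.
by rewrite (h0 nu) // ; ring.
Qed.

(** The Hecke operator fixes [P], because the difference vanishes at all nodes up to degree |mu|,
    that of [mu] included. This amounts to (t x_i - x_j) (sP - P) = 0. *)
Lemma Good_sym n (i j : 'I_n) (mu : 'X_{1..n}) P : j = i.+1 :> nat ->
  mu i = mu j -> Good mu P -> msym (tperm i j) P = P.
Proof.
move=> ij e [hP h0]; have nij := adj_neq ij.
have [Q hQ] := Hecke_exists i j t%:P P.
have QP : Q = P.
  apply/eqP; rewrite -subr_eq0; apply/eqP; apply: (@anode_vanish _ (mdeg mu).+1).
    by apply: msizeB_leq => //; apply: leq_trans hP; apply: Hecke_msize hQ.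
  move=> nu hnu; rewrite mevalB; have xy := anode_adj_neq nu ij.
  have xy' : anode nu i - anode nu j != 0 by rewrite subr_eq0.
  apply: (mulfI xy'); rewrite mulr0 mulrBr (Hecke_eval _ hQ).
  have [e'|ne'] := eqVneq (nu i) (nu j).
    have -> : anode nu j = t%:P * anode nu i by rewrite mul_polyC (anode_eq_adj ij).
    by ring.
  have nm (nu' : 'X_{1..n}) : nu' i != nu' j -> nu' <> mu.
    by move=> + e2; rewrite e2 e eqxx.
  rewrite (meval_eq _ (anode_swap ij ne')) !h0 ?mdeg_mperm //; try exact: nm.
    by rewrite !mulr0 addr0 subrr.
  by apply: nm; rewrite !mnmE tpermL tpermR eq_sym.
rewrite QP in hQ; move: hQ; rewrite /Hecke -!mul_mpolyC rmorphB rmorph1 => hQ.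
have nz : t%:P%:MP * 'X_i - 'X_j != 0 :> {mpoly A[n]}.
  apply/eqP => /(congr1 (mcoeff U_(j))); rewrite mcoeffB mcoeffCM !mcoeffXU.
  rewrite eqxx (negbTE nij) mulr0 sub0r mcoeff0 => /eqP.
  by rewrite oppr_eq0 oner_eq0.
apply: (mulfI nz); apply: (addIr ((1 - t%:P%:MP) * 'X_i * P)).
by rewrite -hQ; ring.
Qed.

End Nodes.

(** * Sorting a composition by adjacent exchanges *)

Section Sorting.
Variable n : nat.
Implicit Types (mu nu : 'X_{1..n}) (i j l : 'I_n).

Definition incr_supp nu : Prop :=
  forall l j, (l < j)%N -> (0 < nu l)%N -> (0 < nu j)%N -> (nu l <= nu j)%N.

Definition weakly_incr nu : Prop := forall l j, (l <= j)%N -> (nu l <= nu j)%N.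

Lemma weakly_incr_sorted nu : weakly_incr nu -> sorted leq nu.
Proof.
move=> h; apply/(sortedP 0%N) => i; rewrite size_tuple => hi.
have hi' := ltnW hi.
by have := h (Ordinal hi') (Ordinal hi) (leqnSn i); rewrite !(mnm_nth 0%N).
Qed.

Lemma adj_weakly_incr nu : (forall i j, j = i.+1 :> nat -> (nu i <= nu j)%N) -> weakly_incr nu.
Proof.
move=> h l j; have [m] := ubnP (j - l); elim: m j => // m IH j hm.
rewrite leq_eqVlt => /orP[/eqP/val_inj -> //|lj].
have hj : (j.-1 < n)%N by rewrite (leq_ltn_trans (leq_pred _)).
have e : j = (Ordinal hj).+1 :> nat by rewrite /= prednK // (leq_ltn_trans _ lj).
apply: leq_trans (h _ _ e); apply: IH; rewrite /=; lia.
Qed.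

Lemma perm_mperm nu (s : 'S_n) : perm_eq (nu#s) nu.
Proof.
by apply/tuple_permP; exists s.
Qed.

Lemma incr_supp_swap nu i j : j = i.+1 :> nat -> nu j = 0%N ->
  incr_supp nu -> incr_supp (nu#(tperm i j)).
Proof.
move=> ij z h l m lm; rewrite !mnmE => pl pm.
apply: h => //; rewrite tperm_adj_lt //.
  apply/negP => /andP[/eqP el /eqP em]; move: pl; rewrite el tpermL z; lia.
by apply/negP => /andP[/eqP el /eqP em]; move: lm; rewrite el em ij; lia.
Qed.

Lemma sum_split2 i j (f : 'I_n -> nat) : i != j ->
  (\sum_l f l = f i + (f j + \sum_(l | (l != i) && (l != j)) f l))%N.
Proof. by move=> ij; rewrite (bigD1 i) //= (bigD1 j) 1?eq_sym. Qed.

(** Each move brings a nonzero part one place closer to the right end, so the process stops. Then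
    all zeros are in front, and the nonzero parts were increasing from the start. *)
Lemma swap_sort (Q : 'X_{1..n} -> Prop) :
  (forall nu i j, j = i.+1 :> nat -> incr_supp nu -> (0 < nu i)%N -> nu j = 0%N ->
     Q nu -> Q (nu#(tperm i j))) ->
  forall nu, incr_supp nu -> Q nu ->
    exists nu', [/\ weakly_incr nu', perm_eq nu' nu & Q nu'].
Proof.
move=> step nu; pose w nu := (\sum_(i < n) (n - i) * (0 < nu i))%N.
have [m] := ubnP (w nu); elim: m nu => // m IH nu hm hinc hQ.
have [/existsP[i /existsP[j /and3P[/eqP ij pi /eqP z]]]|none] :=
  boolP [exists i : 'I_n, exists j : 'I_n,
    [&& j == i.+1 :> nat, 0 < nu i & nu j == 0]%N]; last first.
  exists nu; split=> //; apply: adj_weakly_incr => i j ij.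
  move: none; rewrite negb_exists => /forallP/(_ i).
  rewrite negb_exists => /forallP/(_ j); rewrite ij eqxx /= negb_and -leqNgt leqn0 -lt0n.
  have [->//|pi] := posnP (nu i); move=> /= pj; apply: hinc; rewrite ?ij //.
have [|||nu' [h1 h2 h3]] := IH (nu#(tperm i j)).
- rewrite ltnS in hm; apply: leq_trans hm; rewrite /w !(sum_split2 _ (adj_neq ij)).
  rewrite !mnmE tpermL tpermR pi z ij.
  rewrite (eq_bigr (fun l : 'I_n => (n - l) * (0 < nu l))%N).
    by rewrite !muln0 !muln1 add0n ltn_add2r; have := ltn_ord j; lia.
  by move=> l /andP[li lj]; rewrite mnmE tpermD // eq_sym.
- exact: incr_supp_swap.
- exact: step.
by exists nu'; split=> //; apply: (perm_trans h2); apply: perm_mperm.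
Qed.

Definition binary nu : Prop := forall i, (nu i <= 1)%N.

Lemma binary_incr_supp nu : binary nu -> incr_supp nu.
Proof. by move=> h l j _ _; apply: leq_trans; apply: h. Qed.

Lemma leq_mdeg_eq nu nu' : (forall i, nu i <= nu' i)%N -> mdeg nu = mdeg nu' -> nu = nu'.
Proof.
move=> h e; have eB : nu' = (nu + (nu' - nu))%MM.
  by apply/mnmP => i; rewrite mnmDE mnmBE subnKC.
have : mdeg (nu' - nu)%MM == 0%N.
  by rewrite -(eqn_add2l (mdeg nu)) -mdegD -eB e addn0.
by rewrite mdeg_eq0 => /eqP z; rewrite eB z; apply/mnmP => i; rewrite mnmDE mnm0E addn0.
Qed.

Lemma weakly_incr_binary_eq nu nu' : weakly_incr nu -> weakly_incr nu' -> binary nu -> binary nu' ->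
  mdeg nu = mdeg nu' -> nu = nu'.
Proof.
move=> m1 m2 b1 b2 e.
have [/forallP h|] := boolP [forall i, nu i <= nu' i]%N; first exact: leq_mdeg_eq.
rewrite negb_forall => /existsP[l]; rewrite -ltnNge => hl.
apply/esym/leq_mdeg_eq => // i; have [il|li] := leqP i l.
  by have := m2 _ _ il; have := b1 l; lia.
by have := m1 _ _ (ltnW li); have := b2 i; lia.
Qed.

Definition wt nu : nat := (\sum_(i < n) i * nu i)%N.

Lemma wt_swap nu i j : j = i.+1 :> nat ->
  (wt (nu#(tperm i j)) + nu j = wt nu + nu i)%N.
Proof.
move=> ij; rewrite /wt !(sum_split2 _ (adj_neq ij)) !mnmE tpermL tpermR ij.
rewrite (eq_bigr (fun l : 'I_n => l * nu l)%N).
  by move: (\sum_(_ | _) _)%N => S; lia.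
by move=> l /andP[li lj]; rewrite mnmE tpermD // eq_sym.
Qed.

(** The arrangement of (1^k) with the same zeros, k being the number of nonzero parts. *)
Definition chi nu : 'X_{1..n} := [multinom (0 < nu i : nat)%N | i < n].

Lemma chiE nu i : chi nu i = (0 < nu i)%N. Proof. by rewrite mnmE. Qed.

Lemma chi_binary nu : binary (chi nu).
Proof. by move=> i; rewrite chiE leq_b1. Qed.

Lemma chi_mperm nu s : chi (nu#s) = (chi nu)#s.
Proof. by apply/mnmP => i; rewrite !mnmE. Qed.

Lemma wt_chi_swap mu i j : j = i.+1 :> nat -> (0 < mu i)%N -> mu j = 0%N ->
  wt ((chi mu)#(tperm i j)) = (wt (chi mu)).+1.
Proof.
by move=> ij pi z; have := wt_swap (chi mu) ij; rewrite !chiE pi z addn0 addn1.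
Qed.

(** When the nonzero parts increase, larger indices come first among them whatever their values, as
    in the 0/1 case. So the nodes of [nu] and [chi nu] agree at q = 1. *)
Lemma comp_k_chi nu i : incr_supp nu -> comp_k (chi nu) i = comp_k nu i.
Proof.
move=> h; apply: comp_k_dom => l _; rewrite /dom !chiE.
have := h l i; have := h i l; case: ltngtP => // _; case: (nu i) => [|a]; case: (nu l) => [|b] //=.
- by move=> /(_ isT isT isT) ->.
- by move=> _ /(_ isT isT isT); lia.
Qed.

Lemma comp_k_descent nu i j : j = i.+1 :> nat -> (nu j < nu i)%N ->
  (comp_k nu i < comp_k nu j)%N.
Proof.
move=> ij lt; rewrite !comp_kE; apply/proper_card/properP; split.
  apply/subsetP => l; rewrite !inE /dom.
  have [->|lj] := eqVneq l j; first by rewrite ij; lia.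
  by move: lj; rewrite -val_eqE /= ij; lia.
by exists i; rewrite inE ?dom_irr // /dom ij leqnn lt.
Qed.

(** The exchange produces a sorted composition, so [i] is the last nonzero position in the order,
    and [j], the rightmost zero, follows it directly. *)
Lemma comp_k_last_descent nu i j : j = i.+1 :> nat -> (0 < nu i)%N -> nu j = 0%N ->
  weakly_incr (nu#(tperm i j)) -> comp_k nu j = (comp_k nu i).+1.
Proof.
move=> ij pi z m; rewrite !comp_kE.
have -> : [set l | dom nu l j] = i |: [set l | dom nu l i]; last first.
  by rewrite cardsU1 inE dom_irr.
apply/setP => l; rewrite !inE.
have [->|li] := eqVneq l i; first by rewrite /dom ij leqnn z pi.
have [->|lj] := eqVneq l j; first by rewrite dom_irr /dom ij z; lia.
have := m l i; have := m j l; rewrite !mnmE tpermL tpermR.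
rewrite tpermD 1?eq_sym // z /dom z; move: li lj; rewrite -!val_eqE /= ij; lia.
Qed.

(** A transposition is conjugate to a shorter one by an adjacent transposition, and transpositions
    generate the symmetric group. *)
Lemma adj_symmetric (R : comNzRingType) (g : {mpoly R[n]}) :
  (forall i j, j = i.+1 :> nat -> msym (tperm i j) g = g) -> g \is symmetric.
Proof.
move=> h; have ht i j : (i < j)%N -> msym (tperm i j) g = g.
  have [m] := ubnP (j - i); elim: m j => // m IH j hm ij.
  have hj : (j.-1 < n)%N by rewrite (leq_ltn_trans (leq_pred _)).
  pose j' := Ordinal hj.
  have e : j = j'.+1 :> nat by rewrite /= prednK // (leq_ltn_trans _ ij).
  have [/val_inj eij|ne] := eqVneq (val i) (val j'); first by rewrite -eij in e; apply: h.
  have -> : tperm i j = (tperm j' j * tperm i j' * tperm j' j)%g.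
    have n1 : j' != i by rewrite -val_eqE eq_sym.
    have n2 : j != i by rewrite -val_eqE neq_ltn ij orbT.
    by rewrite -{1}[tperm j' j]tpermV -mulgA -conjgE tpermJ tpermL (tpermD n1 n2).
  rewrite !msymMm h // IH ?h //; first by move: hm e; rewrite /=; lia.
  by move: ne e; rewrite /=; lia.
apply/issymP => s; case: (prod_tpermP s) => ts -> _.
elim/big_rec: _ => [|[a b] s' _ ih]; first by rewrite msym1m.
rewrite msymMm /=; have [ab|ba|/val_inj ->] := ltngtP a b.
- by rewrite ht.
- by rewrite tpermC ht.
- by rewrite tperm1 msym1m.
Qed.

End Sorting.

(** * Moving the zeros to the front *)

Section Chain.
Variables (F : fieldType) (t : F).
Local Notation A := {poly F}.
Local Notation at1 := (map_mpoly (horner_eval (1 : F))).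
Local Notation cst := (map_mpoly (@polyC F)).
Local Notation node := (anode t).
Variable n : nat.
Implicit Types (mu nu : 'X_{1..n}) (i j l : 'I_n) (f g e : {mpoly F[n]}).

Definition supp_card nu : nat := #|[set l | (0 < nu l)%N]|.

Lemma supp_card_mperm nu s : supp_card (nu#s) = supp_card nu.
Proof.
rewrite /supp_card -[RHS](card_imset _ (@perm_inj _ s^-1)).
congr #|pred_of_set _|; apply/setP => l; rewrite inE mnmE.
apply/idP/imsetP => [h|[m]]; first by exists (s l); rewrite ?inE ?permK.
by rewrite inE => h ->; rewrite permKV.
Qed.

Lemma supp_card_binary nu k : (mdeg nu <= k)%N -> (k <= supp_card nu)%N ->
  binary nu /\ mdeg nu = k.
Proof.
move=> h1 h2; have e : mdeg (chi nu) = supp_card nu.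
  rewrite mdegE /supp_card -sum1_card [RHS]big_mkcond /=; apply: eq_bigr => i _.
  by rewrite chiE inE; case: (0 < _)%N.
have le i : (chi nu i <= nu i)%N by rewrite chiE; case: (nu i).
have le2 : (mdeg (chi nu) <= mdeg nu)%N by rewrite !mdegE leq_sum.
have en : chi nu = nu by apply: leq_mdeg_eq => //; lia.
by split; [rewrite -en; apply: chi_binary|lia].
Qed.

Lemma anode_at1 nu i : (node nu i).[1] = t ^- comp_k nu i.
Proof. by rewrite /anode hornerZ hornerXn expr1n mulr1. Qed.

Lemma Hecke_uniq i j (R : idomainType) (u : R) (P Q Q' : {mpoly R[n]}) : i != j ->
  Hecke i j u P Q -> Hecke i j u P Q' -> Q = Q'.
Proof. by move=> ij h h'; apply: (mulfI (XsubX_neq0 ij R)); rewrite h h'. Qed.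

Lemma Hecke_at1 i j P Q : Hecke i j t%:P P Q -> Hecke i j t (at1 P) (at1 Q).
Proof. by move/(Hecke_map (horner_eval (1 : F))); rewrite /= /horner_eval hornerC. Qed.

(* The quadratic relation (T - 1) (T + t) = 0. *)
Lemma Hecke_add_sym i j g g1 : i != j -> Hecke i j t g g1 ->
  msym (tperm i j) (g1 + t *: g) = g1 + t *: g.
Proof.
move=> ij h; apply: (mulfI (XsubX_neq0 ij F)).
have e : ('X_i - 'X_j) * (g1 + t *: g)
  = (t *: 'X_i - 'X_j) * msym (tperm i j) g + ('X_i - t *: 'X_j) * g.
  by rewrite mulrDr h -!mul_mpolyC rmorphB rmorph1; ring.
have := congr1 (msym (tperm i j)) e.
rewrite !(msymM, msymN, msymD, msymZ) !msymXU tpermL tpermR.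
rewrite -msymMm tperm2 msym1m => e'.
rewrite -[LHS]opprK -mulNr opprB e' e.
by rewrite -!mul_mpolyC; ring.
Qed.

Hypothesis t_neq0 : t != 0.
Hypothesis t_inj : forall k l : nat, t ^- k = t ^- l -> k = l.

(** If [G] vanishes at the node of [nu], only the term with the factor t x_i - x_j is left, and this
    factor is zero when the two parts are equal. *)
Lemma Hecke_comb_neq0 i j c d (G G1 : {mpoly A[n]}) nu : j = i.+1 :> nat ->
  Hecke i j t%:P G G1 -> (c *: G1 - d *: G).@[node nu] != 0 ->
  G.@[node nu] != 0 \/ nu i != nu j /\ G.@[node (nu#(tperm i j))] != 0.
Proof.
move=> ij hG; rewrite mevalB !mevalZ.
have [e0|] := eqVneq G.@[node nu] 0; last by left.
rewrite e0 mulr0 subr0 => h; right.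
have h1 : G1.@[node nu] != 0 by apply: contraNneq h => ->; rewrite mulr0.
have h2 := Hecke_eval (node nu) hG; rewrite e0 mulr0 addr0 in h2.
have h3 : (node nu i - node nu j) * G1.@[node nu] != 0.
  by rewrite mulf_neq0 // subr_eq0; apply: anode_adj_neq.
rewrite h2 in h3; have [e|ne] := eqVneq (nu i) (nu j).
  by rewrite mul_polyC (anode_eq_adj t_neq0 ij e) subrr mul0r eqxx in h3.
split=> //; apply: contraNneq h3 => h4.
by rewrite (meval_eq _ (anode_swap t ij ne)) h4 mulr0.
Qed.

Lemma Hecke_comb_swap_neq0 i j c d (G G1 : {mpoly A[n]}) nu : j = i.+1 :> nat ->
  Hecke i j t%:P G G1 -> nu i = 0%N -> nu j = 1%N -> c != 0 ->
  G.@[node nu] = 0 -> G.@[node (nu#(tperm i j))] != 0 ->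
  (c *: G1 - d *: G).@[node nu] != 0.
Proof.
move=> ij hG nui nuj c0 e0 hnz; rewrite mevalB !mevalZ e0 mulr0 subr0 mulf_neq0 //.
have := Hecke_eval (node nu) hG; rewrite e0 mulr0 addr0.
have ne : nu i != nu j by rewrite nui nuj.
rewrite (meval_eq _ (anode_swap t ij ne)) => h.
have : (node nu i - node nu j) * G1.@[node nu] != 0.
  rewrite h mulf_neq0 // subr_eq0 mul_polyC /anode nui nuj scalerA.
  apply/eqP => /(congr1 (fun p : A => size p)).
  by rewrite !size_scale ?size_polyXn // ?mulf_neq0 ?tV_neq0.
by apply: contraNneq => ->; rewrite mulr0.
Qed.

(** [g] will come from setting q = 1, yet the nodes keep q as a variable, so [anode_vanish] applies
    again. *)
Definition vanish_supp k g : Prop :=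
  forall nu, (supp_card nu < k)%N -> (cst g).@[node nu] = 0.

(* The value at q = 1 of the polynomial attached to [chi mu] is [g]; the one
   attached to [mu] specialises to [f * g], the exponents of t in the nodes of
   [mu] and [chi mu] being the same. *)
Record chain_inv k f mu (P Q : {mpoly A[n]}) : Prop := ChainInv {
  ci_deg : mdeg (chi mu) = k;
  ci_good : Good t mu P;
  ci_at1 : at1 P = f * at1 Q;
  ci_good_chi : Good t (chi mu) Q;
  ci_vanish : vanish_supp k (at1 Q);
  ci_triangular : forall nu, binary nu -> mdeg nu = k ->
    (cst (at1 Q)).@[node nu] != 0 -> nu = chi mu \/ (wt nu < wt (chi mu))%N;
  ci_nonzero : (cst (at1 Q)).@[node (chi mu)] != 0;
  ci_sym : weakly_incr mu -> forall i j, j = i.+1 :> nat -> mu i = 0%N -> (0 < mu j)%N ->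
    msym (tperm i j) (at1 Q) = at1 Q }.

Lemma cstB g e : cst (g - e) = cst g - cst e.
Proof. exact: rmorphB. Qed.

Lemma cstZ c g : cst (c *: g) = c%:P *: cst g.
Proof. exact: map_mpolyZ. Qed.

(** The exchange is applied to [P] and [Q] together. At q = 1 both combinations have the same
    constants, since the nodes of [mu] and [chi mu] agree there, and the symmetric factor [f]
    commutes with the operator. *)
Lemma chain_step k f mu i j P Q : j = i.+1 :> nat -> incr_supp mu ->
  (forall s, msym s f = f) -> (0 < mu i)%N -> mu j = 0%N ->
  chain_inv k f mu P Q -> exists P' Q', chain_inv k f (mu#(tperm i j)) P' Q'.
Proof.
move=> ij inc symf pi z [hk gP eP gQ hv htri hnz hsym].
have nij := adj_neq ij.
have [P1 hP] := Hecke_exists i j t%:P P.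
have [Q1 hQ] := Hecke_exists i j t%:P Q.
have e1 : at1 P1 = f * at1 Q1.
  apply: (Hecke_uniq nij (Hecke_at1 hP)); rewrite eP.
  exact: Hecke_mull (symf _) (Hecke_at1 hQ).
set x := t ^- comp_k mu i; set y := t ^- comp_k mu j.
have xy : x - y != 0.
  rewrite subr_eq0; apply/eqP => /t_inj e.
  by have := @comp_k_descent _ mu i j ij; rewrite z pi e ltnn => /(_ isT).
set a := node mu i; set b := node mu j.
have [ax by_] : a.[1] = x /\ b.[1] = y by rewrite !anode_at1.
set a' := node (chi mu) i; set b' := node (chi mu) j.
have [ax' by'] : a'.[1] = x /\ b'.[1] = y by rewrite !anode_at1 !comp_k_chi.
have chi_ij : chi mu i != chi mu j by rewrite !chiE pi z.
pose P' := (a - b) *: P1 - ((1 - t%:P) * a) *: P.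
pose Q' := (a' - b') *: Q1 - ((1 - t%:P) * a') *: Q.
have eQ' : at1 Q' = (x - y) *: at1 Q1 - ((1 - t) * x) *: at1 Q.
  rewrite rmorphB /= !at1Z hornerM !hornerD !hornerN !hornerC ax' by'.
  by congr (_ - _).
have eP' : at1 P' = f * at1 Q'.
  rewrite eQ' rmorphB /= !at1Z hornerM !hornerD !hornerN !hornerC ax by_ e1 eP.
  by rewrite mulrBr -!scalerAr.
have hg := Hecke_map (@polyC F) (Hecke_at1 hQ).
have eC : cst (at1 Q') = (x - y)%:P *: cst (at1 Q1) - ((1 - t) * x)%:P *: cst (at1 Q).
  by apply: (etrans (congr1 _ eQ')); apply: (etrans (cstB _ _)); congr (_ - _); apply: cstZ.
have val_neq0 nu : (cst (at1 Q')).@[node nu] != 0 -> (cst (at1 Q)).@[node nu] != 0 \/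
    nu i != nu j /\ (cst (at1 Q)).@[node (nu#(tperm i j))] != 0.
  by rewrite eC; apply: Hecke_comb_neq0 ij hg.
have wtE := wt_chi_swap ij pi z.
have gP' : Good t (mu#(tperm i j)) P'.
  by apply: Good_swap => //; rewrite z -lt0n.
have gQ' : Good t (chi (mu#(tperm i j))) Q'.
  by rewrite chi_mperm; apply: Good_swap.
clearbody P' Q' a b a' b'; exists P', Q'; apply: ChainInv.
- by rewrite chi_mperm mdeg_mperm.
- exact: gP'.
- exact: eP'.
- exact: gQ'.
- move=> nu hnu; apply/eqP; apply: contraT => /val_neq0[|[_]].
    by rewrite hv ?eqxx.
  by rewrite hv ?eqxx // supp_card_mperm.
(* A nonzero value at [nu] comes from [nu] or from its exchange, and an exchange alters the weight
   of a 0/1 vector by at most 1. *)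
- move=> nu bnu dnu; rewrite chi_mperm wtE => /val_neq0[/(htri _ bnu dnu)|[ne h]].
    by case=> [->|h]; right; [rewrite ltnSn|rewrite ltnS ltnW].
  have bs : binary (nu#(tperm i j)) by move=> l; rewrite mnmE; apply: bnu.
  have ds : mdeg (nu#(tperm i j)) = k by rewrite mdeg_mperm.
  have [e|h'] := htri _ bs ds h; first by left; rewrite -e mperm_tpermK.
  by right; have := wt_swap nu ij; have := bnu j; lia.
- rewrite chi_mperm; set nu := (chi mu)#_.
  have nui : nu i = 0%N by rewrite mnmE tpermL chiE z.
  have nuj : nu j = 1%N by rewrite mnmE tpermR chiE pi.
  (* Triangularity gives zero here, the weight of [nu] exceeding that of [chi mu]; the new value
     therefore comes from [chi mu] alone. *)
  have e0 : (cst (at1 Q)).@[node nu] = 0.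
    apply/eqP; apply: contraT => /htri[||e|].
    + by move=> l; rewrite mnmE chi_binary.
    + by rewrite mdeg_mperm.
    + by have := chiE mu i; rewrite -e nui pi.
    + by rewrite wtE ltnNge leqnSn.
  rewrite eC; apply: (Hecke_comb_swap_neq0 _ ij hg nui nuj _ e0).
    by rewrite polyC_eq0.
  by rewrite mperm_tpermK.
move=> mm i' j' ij' z' p'.
have zi : (mu#(tperm i j)) i = 0%N by rewrite mnmE tpermL.
have pj : (0 < (mu#(tperm i j)) j)%N by rewrite mnmE tpermR.
(* A weakly increasing composition passes from zero to nonzero parts only once. *)
have ei : i' = i.
  apply/val_inj; have [lt|lt|//] := ltngtP (val i') (val i).
    by have := mm j' i; rewrite zi ij' => /(_ lt); lia.
  by have := mm j i'; rewrite z' ij => /(_ lt); lia.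
have ej : j' = j by apply/val_inj; rewrite /= ij' ij ei.
rewrite {}ei {}ej eQ'.
have yx : y = t^-1 * x.
  by rewrite /y (comp_k_last_descent ij pi z mm) exprS invfM.
(* As y = x / t, the combination is a multiple of T + t, whose image is symmetric in x_i and x_j by
   the quadratic relation. *)
have -> : (x - y) *: at1 Q1 - ((1 - t) * x) *: at1 Q
   = (x - y) *: (at1 Q1 + t *: at1 Q).
  rewrite scalerDr scalerA -scaleNr; congr (_ + _ *: _).
  have tx : t^-1 * x * t = x by rewrite mulrC mulrA divff ?mul1r.
  by rewrite yx [RHS]mulrBl tx; ring.
by rewrite linearZ /= (Hecke_add_sym nij (Hecke_at1 hQ)).
Qed.

Lemma chain_sort k f mu P Q : incr_supp mu -> (forall s, msym s f = f) ->
  chain_inv k f mu P Q ->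
  exists mu' P' Q', [/\ weakly_incr mu', perm_eq mu' mu & chain_inv k f mu' P' Q'].
Proof.
move=> inc symf inv0.
have [||mu' [h1 h2 [P' [Q' h3]]]] :=
  @swap_sort _ (fun mu => exists P Q, chain_inv k f mu P Q) _ _ inc.
- by move=> nu i j ij hnu pi z [P1 [Q1]]; apply: chain_step.
- by exists P, Q.
by exists mu', P', Q'.
Qed.

Lemma chain_final_sym k f mu P Q : weakly_incr mu -> chain_inv k f mu P Q ->
  at1 Q \is symmetric.
Proof.
move=> mm inv; apply: adj_symmetric => i j ij.
have [pi|pi] := posnP (mu i); have [pj|pj] := posnP (mu j); last first.
- rewrite -map_msym (Good_sym t_neq0 t_inj ij _ (ci_good_chi inv)) //.
  by rewrite !chiE pi pj.
- by have := mm i j; rewrite ij leqnSn pj => /(_ isT); lia.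
- exact: ci_sym inv mm _ _ ij pi pj.
- rewrite -map_msym (Good_sym t_neq0 t_inj ij _ (ci_good_chi inv)) //.
  by rewrite !chiE pi pj.
Qed.

(** Exchanging unequal neighbours permutes the coordinates of the node, so a 0/1 vector can be
    sorted without changing the value of [h]. *)
Lemma sym_binary_eval (h : {mpoly A[n]}) nu nu' : h \is symmetric ->
  binary nu -> binary nu' -> mdeg nu = mdeg nu' -> h.@[node nu] = h.@[node nu'].
Proof.
move=> /issymP symh.
have key mu : binary mu -> exists mu',
    [/\ weakly_incr mu', binary mu', mdeg mu' = mdeg mu & h.@[node mu'] = h.@[node mu]].
  move=> bmu; have [||mu' [h1 _ [h2 h3 h4]]] := @swap_sort _
    (fun mu' => [/\ binary mu', mdeg mu' = mdeg mu & h.@[node mu'] = h.@[node mu]])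
    _ _ (binary_incr_supp bmu); last by exists mu'.
  - move=> mu' i j ij _ pi z [h1 h2 h3]; split.
    + by move=> l; rewrite mnmE; apply: h1.
    + by rewrite mdeg_mperm.
    + have ne : mu' i != mu' j by rewrite z -lt0n.
      by rewrite -(meval_eq _ (anode_swap t ij ne)) -meval_msym symh.
  - by [].
move=> b1 b2 e; have [m1 [h1 h2 h3 <-]] := key _ b1; have [m2 [k1 k2 k3 <-]] := key _ b2.
by rewrite (weakly_incr_binary_eq h1 k1) // h3 k3.
Qed.

(** A composition of degree at most k either has fewer than k nonzero parts, and both polynomials
    vanish, or is a 0/1 vector with k ones, and each polynomial takes a single value on all of
    these. So the difference of the two sides vanishes at all nodes up to degree k. *)
Lemma sym_vanish_proportional k g e chi0 : g \is symmetric -> e \is symmetric ->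
  (msize g <= k.+1)%N -> (msize e <= k.+1)%N ->
  vanish_supp k g -> vanish_supp k e -> binary chi0 -> mdeg chi0 = k ->
  (cst g).@[node chi0] *: cst e = (cst e).@[node chi0] *: cst g.
Proof.
move=> sg se zg ze vg ve bc dc; apply/eqP; rewrite -subr_eq0; apply/eqP.
have symc p : p \is symmetric -> cst p \is symmetric.
  by move=> /issymP sp; apply/issymP => s; rewrite -map_msym sp.
apply: (@anode_vanish _ t t_neq0 t_inj _ k.+1).
  by apply: msizeB_leq; apply: (leq_trans (msizeZ_le _ _));
     apply: (leq_trans (msize_map_mpoly _ _)).
move=> nu; rewrite ltnS => hnu; rewrite meval_comb.
have [lt|ge] := ltnP (supp_card nu) k.
  have aux (a b c d : A) : c = 0 -> d = 0 -> a * c - b * d = 0.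
    by move=> -> ->; rewrite !mulr0 subrr.
  by apply: aux; [apply: ve|apply: vg].
have [bn dn] := supp_card_binary hnu ge.
have eg := sym_binary_eval (symc _ _ sg) bn bc (etrans dn (esym dc)).
have ee := sym_binary_eval (symc _ _ se) bn bc (etrans dn (esym dc)).
have aux (a a' b b' : A) : a = a' -> b = b' -> a' * b - b' * a = 0.
  by move=> -> ->; rewrite mulrC subrr.
exact: aux eg ee.
Qed.

End Chain.

(** * Elementary interpolation polynomials *)

Lemma card_ord_lt n k : (k <= n)%N -> #|[set l : 'I_n | (l < k)%N]| = k.
Proof.
move=> kn; rewrite -sum1dep_card -(big_ord_widen _ (fun=> 1%N)) //.
by rewrite sum1_card card_ord.
Qed.

Section ElementaryInterpolation.
Variables (F : fieldType) (t : F) (n : nat).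
Local Notation cst := (map_mpoly (@polyC F)).
Implicit Types (S : {set 'I_n}) (i j : 'I_n) (m k : nat).

Definition eterm S i : {mpoly F[n]} :=
  'X_i - (t ^+ #|[set j in ~: S | (j < i)%N]| / t ^+ n.-1)%:MP.

(** Limiting the subsets to the first [m] indices gives a recursion in [m], since the exponent
    attached to an element of [S] depends only on smaller indices. *)
Definition epart m k : {mpoly F[n]} :=
  \sum_(S : {set 'I_n} | (S \subset [set i : 'I_n | (i < m)%N]) && (#|S| == k))
    \prod_(i in S) eterm S i.

Lemma epart_full k : epart n k = estar t n k.
Proof.
apply: eq_bigl => S; rewrite andb_idl // => _.
by apply/subsetP => i _; rewrite inE.
Qed.

Lemma epart0 m : epart m 0 = 1.
Proof.
rewrite /epart (big_pred1 set0) ?big_set0 // => S.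
by rewrite cards_eq0 andb_idl // => /eqP ->; apply: sub0set.
Qed.

Lemma epart_0S k : epart 0 k.+1 = 0.
Proof.
rewrite /epart big1 // => S /andP[hS /eqP cS]; exfalso.
have := subset_leq_card hS; rewrite cS (_ : [set _ | _] = set0) ?cards0 //.
Qed.

(** The subsets are split by membership of [i]. If [i] belongs to one, it is the largest element,
    and i - k smaller indices lie outside. *)
Lemma epartS i k : epart i.+1 k.+1 = epart i k.+1
  + ('X_i - (t ^+ (i - k) / t ^+ n.-1)%:MP) * epart i k.
Proof.
rewrite {1}/epart (bigID (fun S => i \in S)) /= addrC; congr (_ + _).
  apply: eq_bigl => S; rewrite -andbA [X in _ && X]andbC andbA; congr (_ && _).
  apply/andP/subsetP => [[/subsetP h iS] l lS|h].
    have := h _ lS; rewrite !inE ltnS leq_eqVlt => /orP[/eqP/val_inj e|//].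
    by rewrite -e lS in iS.
  split; first by apply/subsetP => l /h; rewrite !inE => /ltnW.
  by apply/negP => /h; rewrite inE ltnn.
rewrite (reindex_onto (fun S => i |: S) (fun S => S :\ i)) /=; last first.
  by move=> S /andP[_ iS]; rewrite setD1K.
have predE S : [&& [&& i |: S \subset [set l : 'I_n | (l < i.+1)%N] & #|i |: S| == k.+1]
    & i \in i |: S] && ((i |: S) :\ i == S)
    = (S \subset [set l : 'I_n | (l < i)%N]) && (#|S| == k).
  apply/idP/andP => [/andP[/andP[/andP[/subsetP h c] _] /eqP e]|[/subsetP h c]].
    have niS : i \notin S by rewrite -e !inE eqxx.
    rewrite cardsU1 niS in c; split=> //; apply/subsetP => l lS.
    have := h l; rewrite !inE lS orbT => /(_ isT); rewrite ltnS leq_eqVlt.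
    by move=> /orP[/eqP/val_inj el|//]; rewrite -el lS in niS.
  have niS : i \notin S by apply/negP => /h; rewrite inE ltnn.
  rewrite setU11 setU1K // eqxx !andbT cardsU1 niS; apply/andP; split=> //.
  by apply/subsetP => l; rewrite !inE ltnS => /orP[/eqP ->|/h]; rewrite ?inE; lia.
rewrite /epart mulr_sumr; apply: eq_big => [S|S]; first exact: predE.
rewrite predE => /andP[/subsetP h /eqP c].
have niS : i \notin S by apply/negP => /h; rewrite inE ltnn.
rewrite big_setU1 //=; congr (_ * _).
  rewrite /eterm; congr ('X_i - (_ ^+ _ / _)%:MP).
  have -> : [set j in ~: (i |: S) | (j < i)%N] = [set l : 'I_n | (l < i)%N] :\: S.
    apply/setP => l; rewrite !inE -val_eqE /=.
    by case: (l \in S); rewrite ?orbT //= orbF; case: ltngtP.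
  rewrite cardsD (setIidPr _); last by apply/subsetP.
  by rewrite c; congr (_ - _)%N; apply/card_ord_lt/ltnW.
apply: eq_bigr => l lS; rewrite /eterm; congr ('X_l - (_ ^+ _ / _)%:MP).
congr #|pred_of_set _|; apply/setP => l'; rewrite !inE negb_or -andbA andb_idl //.
move=> /andP[_ ll']; rewrite -val_eqE neq_ltn (ltn_trans ll') //.
by have := h _ lS; rewrite inE.
Qed.

Lemma estar_sym k : estar t n k \is symmetric.
Proof.
rewrite -epart_full; apply: adj_symmetric => i j ij.
have nij := adj_neq ij.
have XE l : l != i -> l != j -> msym (tperm i j) ('X_l : {mpoly F[n]}) = 'X_l.
  by move=> li lj; rewrite msymXU tpermD // eq_sym.
have low m k' : (m <= i)%N -> msym (tperm i j) (epart m k') = epart m k'.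
  elim: m k' => [|m IH] [|k'] hm; rewrite ?epart0 ?epart_0S ?msym0 ?msym1 //.
  have hm' : (m < n)%N by apply: ltn_trans hm (ltn_ord i).
  rewrite (epartS (Ordinal hm')) !(msymM, msymD, msymN) msymC !IH ?(ltnW hm) //.
  by rewrite XE //; apply/eqP => /(congr1 (@nat_of_ord n)) /=; lia.
have mid k' : msym (tperm i j) (epart j.+1 k') = epart j.+1 k'.
  case: k' => [|k']; rewrite ?epart0 ?msym1 // epartS ij.
  case: k' => [|k'].
    rewrite epart0 epartS epart0 !(msymM, msymD, msymN, msym1) !msymC !low //.
    by rewrite !msymXU tpermL tpermR !subn0; ring.
  (* Since j - (k' + 1) = i - k', the product term has the same constant beside x_i and x_j, and the
     sum is symmetric in them. *)
  rewrite !epartS subSS !(msymM, msymD, msymN) !msymC !low //.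
  by rewrite !msymXU tpermL tpermR; ring.
have high m k' : (j < m <= n)%N -> msym (tperm i j) (epart m k') = epart m k'.
  elim: m k' => [|m IH] [|k'] // /andP[hj hm]; first by rewrite epart0 msym1.
  move: hj; rewrite ltnS leq_eqVlt => /orP[/eqP <-|hj]; first exact: mid.
  rewrite (epartS (Ordinal hm)) !(msymM, msymD, msymN) msymC !IH ?hj ?(ltnW hm) //.
  by rewrite XE //; apply/eqP => /(congr1 (@nat_of_ord n)) /=; lia.
by apply: high; rewrite ltn_ord /=.
Qed.

Lemma zeros_supp_card (nu : 'X_{1..n}) : (zeros nu n + supp_card nu)%N = n.
Proof.
rewrite -[RHS](card_ord n) -(cardsC [set l | (0 < nu l)%N]) addnC; congr (_ + _)%N.
by congr #|pred_of_set _|; apply/setP => l; rewrite !inE ltn_ord lt0n negbK.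
Qed.

Hypothesis t_neq0 : t != 0.

Lemma epart_vanish (nu : 'X_{1..n}) m k : (m <= n)%N -> (m < zeros nu m + k)%N ->
  (cst (epart m k)).@[anode t nu] = 0.
Proof.
elim: m k => [|m IH] [|k] hm.
- by rewrite /zeros (_ : [set _ | _] = set0) ?cards0 //; apply/setP.
- by rewrite epart_0S rmorph0 meval0.
- rewrite addn0 => h; exfalso.
  have : (zeros nu m.+1 <= m.+1)%N; last by rewrite leqNgt h.
  elim: (m.+1) hm {h} => [|m' IH'] hm'.
    by rewrite /zeros (_ : [set _ | _] = set0) ?cards0 //; apply/setP.
  rewrite (zerosS nu (Ordinal hm')) /=; have := IH' (ltnW hm').
  by case: (_ == _); lia.
rewrite (zerosS nu (Ordinal hm)) (epartS (Ordinal hm)) => h.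
rewrite rmorphD rmorphM rmorphB /= map_mpolyX map_mpolyC.
rewrite mevalD mevalM mevalB mevalXU mevalC.
have IH' := IH _ (ltnW hm).
have [z|nz] := eqVneq (nu (Ordinal hm)) 0%N; rewrite ?z ?(negbTE nz) ?eqxx in h; last first.
  by rewrite !IH' ?mulr0 ?addr0 //; move: h => /=; lia.
rewrite IH' ?add0r; last by move: h => /=; lia.
have [lt|ge] := ltnP m (zeros nu m + k); first by rewrite IH' ?mulr0.
(* In this boundary case [comp_k_zero] identifies the coordinate with t^(m - k) / t^(n - 1), and the
   linear factor vanishes. *)
have e : zeros nu m = (m - k)%N by move: h => /=; lia.
have ck := comp_k_zero z; rewrite /= in ck.
rewrite /anode z expr0 alg_polyC -e -polyCB (_ : t ^- _ = t ^+ zeros nu m / t ^+ n.-1).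
  by rewrite subrr polyC0 mul0r.
rewrite -[in n.-1]ck /= exprD invfM mulrA mulrAC divff ?mul1r ?expf_neq0 //.
Qed.

Lemma estar_vanish k : vanish_supp t k (estar t n k).
Proof.
move=> nu h; rewrite -epart_full; apply: epart_vanish => //.
by rewrite -[X in (X < _)%N](zeros_supp_card nu) ltn_add2l.
Qed.

Lemma msize_sub_prod (I : finType) (S : {pred I}) (f g : I -> {mpoly F[n]}) :
  (forall x, msize (g x) <= 2)%N -> (forall x, msize (f x - g x) <= 1)%N ->
  (msize (\prod_(x in S) f x - \prod_(x in S) g x) <= #|S|)%N.
Proof.
move=> hg hfg.
suff : (msize (\prod_(x in S) f x - \prod_(x in S) g x) <= \sum_(x in S) 1)%N /\
  (msize (\prod_(x in S) g x) <= (\sum_(x in S) 1).+1)%N.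
  by case; rewrite sum1_card.
elim/big_rec3: _ => [|x d a b _ [h1 h2]]; first by rewrite subrr msize0 msize1.
have hf : (msize (f x) <= 2)%N.
  rewrite -[f x](subrK (g x)); apply: (leq_trans (msizeD_le _ _)).
  by rewrite geq_max hg (leq_trans (hfg x)).
split; last by apply: msizeM_leq.
have -> : f x * b - g x * a = f x * (b - a) + (f x - g x) * a by ring.
apply: (leq_trans (msizeD_le _ _)); rewrite geq_max; apply/andP; split.
  (* The bound 0 says that the difference itself is zero; [msizeM_leq] needs a bound of successor
     form. *)
  case: d h1 h2 => [|d] h1 h2; last by rewrite addnS; apply: msizeM_leq.
  have -> : b - a = 0 by apply/eqP; rewrite -msize_poly_eq0 -leqn0.
  by rewrite mulr0 msize0.
by rewrite add1n; apply: (@msizeM_leq _ _ _ _ 0 d).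
Qed.

Lemma msize_estar_sub k : (msize (estar t n k - mesym n F k) <= k)%N.
Proof.
rewrite /estar /mesym -sumrB; apply: (leq_trans (msize_sum _ _ _)).
apply/bigmax_leqP_seq => S _ /eqP <-; apply: msize_sub_prod => i.
  by rewrite msizeXU.
by rewrite addrAC subrr sub0r msizeN msizeC_leq.
Qed.

Lemma msize_estar k : (msize (estar t n k) <= k.+1)%N.
Proof.
rewrite -[estar t n k](subrK (mesym n F k)); apply: (leq_trans (msizeD_le _ _)).
rewrite geq_max (leq_trans (msize_estar_sub k)) //=.
rewrite /mesym; apply: (leq_trans (msize_sum _ _ _)).
apply/bigmax_leqP_seq => S _ /eqP <-; rewrite -sum1_card.
by apply: msize_prod_leq => i _; rewrite msizeXU.
Qed.

(** The top-degree part of [estar] is the elementary symmetric polynomial, which is unchanged by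
    permuting the variables. *)
Lemma mlead_msym_estar (s : 'S_n) k : (k <= n)%N ->
  mlead (msym s (estar t n k)) = [multinom (i < k : nat)%N | i < n] /\
  mleadc (msym s (estar t n k)) = 1.
Proof.
move=> kn; have /issymP sm := mesym_sym n F k.
rewrite -[estar t n k](subrK (mesym n F k)) msymD sm addrC.
set r := msym s _; have hr : (msize r <= k)%N.
  by apply: leq_trans (msize_msym _ _) (msize_estar_sub k).
have hm : mdeg (mlead (mesym n F k)) = k.
  rewrite mlead_mesym // mdegE -[RHS](card_ord_lt kn) -sum1dep_card [RHS]big_mkcond.
  by apply: eq_bigr => i _; rewrite mnmE; case: (_ < _)%N.
have nr : mesym n F k != 0 by apply: mesym_neq0.
have cr : r@_(mlead (mesym n F k)) = 0.
  by apply/memN_msupp_eq0/msize_mdeg_ge; rewrite hm.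
have l : mlead (mesym n F k + r) = mlead (mesym n F k).
  have [->|r0] := eqVneq r 0; first by rewrite addr0.
  apply: mleadDl; apply: lt_mdeg_ltmc; rewrite hm.
  by rewrite mlead_deg.
by rewrite l mcoeffD cr addr0 mleadc_mesym // mlead_mesym.
Qed.

Lemma estar_seq_sym s : estar_seq t n s \is symmetric.
Proof. by apply: rpred_prod => k _; apply: estar_sym. Qed.

(** After permuting the variables the coefficient is taken at [m], the sum of the leading exponents
    of the factors, each of which has leading coefficient 1. *)
Lemma mcoeff_estar_seq (s : 'S_n) (ks : seq nat) (m : 'X_{1..n}) :
  all (geq n) ks -> (forall i, m i = \sum_(k <- ks) (i < k))%N ->
  (estar_seq t n ks)@_(m#s) = 1.
Proof.
move=> /allP hks hm; rewrite -mcoeff_sym /estar_seq rmorph_prod /=.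
have -> : m = (\sum_(k <- ks) mlead (msym s (estar t n k)))%MM.
  apply/mnmP => i; rewrite hm mnm_sumE big_seq [in RHS]big_seq.
  apply: eq_bigr => k /hks /= kn; have [-> _] := mlead_msym_estar s kn.
  by rewrite mnmE.
rewrite mleadc_prod big_seq big1 // => k /hks /= kn.
by have [_ ->] := mlead_msym_estar s kn.
Qed.

End ElementaryInterpolation.

(** * Induction on the columns *)

Lemma conj_part_pred (s : seq nat) h : head 0%N s = h.+1 ->
  conj_part s = count (leq 1) s :: conj_part (map predn s).
Proof.
move=> hs; rewrite /conj_part hs /mkseq /=; congr (_ :: _).
have -> : head 0%N [seq i.-1 | i <- s] = h by case: s hs => //= a s ->.
rewrite -[1%N]addn0 iotaDl -map_comp; apply: eq_map => j /=.
by rewrite count_map; apply: eq_count => a /=; case: a.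
Qed.

Lemma sorted_nth_geq (s : seq nat) i j : sorted geq s -> (i <= j)%N ->
  (nth 0%N s j <= nth 0%N s i)%N.
Proof.
move=> hs ij; have [js|sj] := ltnP j (size s); last by rewrite nth_default.
have is_ : (i < size s)%N by apply: leq_ltn_trans js.
by apply: (sorted_leq_nth (rev_trans leq_trans) leqnn) => //; rewrite inE.
Qed.

(** Both sides say that the cell in row [i] and column [j] lies in the Young diagram. *)
Lemma sorted_nth_count (s : seq nat) i j : sorted geq s ->
  (i < count (leq j.+1) s)%N = (j < nth 0%N s i)%N.
Proof.
elim: s i => [|a s IH] i hs /=; first by rewrite nth_nil ltn0.
have hs' : sorted geq s by apply: path_sorted hs.
have [ja|aj] := ltnP j a; first by case: i => [|i] //=; rewrite add1n ltnS IH.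
rewrite add0n; have ai := sorted_nth_geq hs (leq0n i); rewrite /= in ai.
rewrite [RHS]ltnNge (leq_trans ai aj) /= (_ : count _ s = 0%N) ?ltn0 //.
apply/eqP; rewrite -leqn0 leqNgt -has_count; apply/hasPn => b bs.
have /(nthP 0%N)[l ls <-] := bs; rewrite /= -leqNgt; apply: leq_trans aj.
exact: (sorted_nth_geq hs (leq0n l.+1)).
Qed.

Lemma sum_conj_part (s : seq nat) i : sorted geq s ->
  (\sum_(k <- conj_part s) (i < k))%N = nth 0%N s i.
Proof.
move=> hs; rewrite /conj_part /mkseq big_map.
rewrite (eq_bigr (fun j => (j < nth 0%N s i) : nat)%N); last first.
  by move=> j _; rewrite sorted_nth_count.
have := sorted_nth_geq hs (leq0n i); rewrite nth0; move: (nth _ _ _) (head _ _) => a b ab.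
rewrite -[in iota _ _](subn0 b) -/(index_iota 0 b) -[RHS](minn_idPl ab) => {ab}.
elim: b => [|b IH]; first by rewrite big_geq // minn0.
by rewrite big_nat_recr //= IH; case: (ltnP b a); lia.
Qed.

Lemma nth_mrev n (lam : n.-tuple nat) i : (i < n)%N ->
  nth 0%N (mrev lam) i = nth 0%N lam (n - i.+1).
Proof. by move=> hi; rewrite /= nth_rev size_tuple. Qed.

Lemma size_mnm n (m : 'X_{1..n}) : size m = n.
Proof. by rewrite size_tuple. Qed.

Lemma conj_part_geq n (lam : n.-tuple nat) : all (geq n) (conj_part lam).
Proof.
apply/allP => k /mapP[j _ ->] /=.
by rewrite -[X in (_ <= X)%N](size_tuple lam) count_size.
Qed.

(** * Iterating the shift *)

Section IteratedPhi.
Variables (F : fieldType) (t : F).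
Local Notation A := {poly F}.
Local Notation at1 := (map_mpoly (horner_eval (1 : F))).
Local Notation cst := (map_mpoly (@polyC F)).
Variable n : nat.
Implicit Types (mu nu : 'X_{1..n.+1}).

Lemma Phi_nth0 nu : nth 0%N (Phi nu) 0 = (nth 0%N nu n).+1.
Proof.
have := PhiE nu ord_max; rewrite rotp_max eqxx addn1 !(mnm_nth 0%N).
by move=> ->.
Qed.

Lemma Phi_nthS nu i : (i < n)%N -> nth 0%N (Phi nu) i.+1 = nth 0%N nu i.
Proof.
move=> hi; have hi' : (i < n.+1)%N by apply: ltnW.
have ne : Ordinal hi' != ord_max by rewrite -val_eqE /= neq_ltn hi.
have := PhiE nu (Ordinal hi'); rewrite (negbTE ne) addn0 !(mnm_nth 0%N) /=.
by rewrite (rotp_lt ne).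
Qed.

Lemma iter_Phi_nth mu m i : (m <= n.+1)%N -> (i < n.+1)%N ->
  nth 0%N (iter m (@Phi n) mu) i
    = if (i < m)%N then (nth 0%N mu (n.+1 - m + i)).+1 else nth 0%N mu (i - m).
Proof.
elim: m i => [|m IH] i hm hi; first by rewrite /= subn0.
rewrite iterS; case: i hi => [|i] hi.
  rewrite Phi_nth0 (IH _ (ltnW hm)) //.
  by rewrite ltnNge -ltnS hm /= addn0 subSS.
rewrite Phi_nthS // (IH _ (ltnW hm) (ltnW hi)) ltnS !subSS.
by case: (ltnP i m) => // h; congr (nth _ _ _).+1; lia.
Qed.

(** The factor acquired at q = 1 after [k] shifts; in n + 1 variables z is t^(-n). *)
Definition staircase k : {mpoly F[n.+1]} :=
  \prod_(i < n.+1 | (i < k)%N) ('X_i - (t ^- n)%:MP).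

Lemma staircaseS k : (k < n.+1)%N ->
  staircase k.+1 = ('X_ord0 - (t ^- n)%:MP) * msym (rotp n) (staircase k).
Proof.
move=> hk; rewrite /staircase rmorph_prod /= (bigD1 ord0) //=; congr (_ * _).
rewrite (reindex_inj (@perm_inj _ (rotp n))) /=; apply: eq_big => i.
  rewrite -rotp_max (inj_eq (@perm_inj _ _)).
  have [->|ne] := eqVneq i ord_max.
    by rewrite andbF; apply/esym/negbTE; rewrite -leqNgt.
  by rewrite (rotp_lt ne) andbT.
by move=> _; rewrite msymB msymC msymXU.
Qed.

Hypothesis t_neq0 : t != 0.
Hypothesis t_inj : forall k l : nat, t ^- k = t ^- l -> k = l.

Lemma Good_iter_Phi mu f P m : f \is symmetric -> Good t mu P -> at1 P = f ->
  (m <= n.+1)%N ->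
  exists Q, Good t (iter m (@Phi n) mu) Q /\ at1 Q = f * staircase m.
Proof.
move=> /issymP symf gP eP; elim: m => [|m IH] hm.
  by exists P; rewrite /staircase big_pred0 ?mulr1.
have [Q [gQ eQ]] := IH (ltnW hm); have [Q' [gQ' eQ']] := Good_Phi gQ.
by exists Q'; split=> //; rewrite eQ' eQ msymM symf staircaseS // mulrCA.
Qed.

Lemma staircase_eval k nu :
  (cst (staircase k)).@[anode t nu]
    = \prod_(i < n.+1 | (i < k)%N) (anode t nu i - (t ^- n)%:P).
Proof.
rewrite /staircase !rmorph_prod /=; apply: eq_bigr => i _.
by rewrite rmorphB /= map_mpolyX map_mpolyC mevalB mevalXU mevalC.
Qed.

Lemma staircase_vanish k nu (i : 'I_n.+1) : (i < k)%N -> nu i = 0%N ->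
  (cst (staircase k)).@[anode t nu] = 0.
Proof.
move=> ik z; rewrite staircase_eval.
(* The first zero part is the one of rank [n], whose coordinate is exactly t^(-n). *)
have [l /eqP zl min] := @arg_minnP _ i (fun l => nu l == 0%N) val (introT eqP z).
have lk : (l < k)%N by apply: leq_ltn_trans ik; apply: min; apply/eqP.
rewrite (bigD1 l) //=; have := comp_k_zero zl.
rewrite /zeros (_ : [set _ | _] = set0) ?cards0 ?addn0; last first.
  apply/setP => m; rewrite !inE; apply/negbTE/negP => /andP[ml /min /=].
  by rewrite leqNgt ml.
by move=> [ck]; rewrite /anode zl ck expr0 alg_polyC subrr mul0r.
Qed.

Lemma staircase_neq0 k nu : (forall i : 'I_n.+1, (i < k)%N -> nu i = 1%N) ->
  (cst (staircase k)).@[anode t nu] != 0.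
Proof.
move=> h; rewrite staircase_eval; apply/prodf_neq0 => i /h e.
rewrite subr_eq0 /anode e -alg_polyC -(expr0 'X).
by apply/eqP => /(scaleXn_inj t_neq0 t_inj)[].
Qed.

(** [Q'] comes from the same shifts applied to the constant 1, for the zero composition. The
    staircase vanishes unless the first [k] parts are nonzero, which leaves only [chi] of the
    shifted [mu] among 0/1 vectors of degree [k]. *)
Lemma chain_start k f mu P : (k <= n.+1)%N -> f \is symmetric -> Good t mu P ->
  at1 P = f -> (forall i, (i < n.+1 - k)%N -> nth 0%N mu i = 0%N) ->
  exists P' Q', chain_inv t k f (iter k (@Phi n) mu) P' Q'.
Proof.
move=> hk symf gP eP hmu.
have [P' [gP' eP']] := Good_iter_Phi symf gP eP hk.
have s1 : (1 : {mpoly F[n.+1]}) \is symmetric by apply: rpred1.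
have g1 : Good t (0%MM : 'X_{1..n.+1}) (1 : {mpoly A[n.+1]}).
  split; first by rewrite mdeg0 msize1.
  by move=> nu; rewrite mdeg0 leqn0 mdeg_eq0 => /eqP ->.
have [Q' [gQ' eQ']] := Good_iter_Phi s1 g1 (rmorph1 _) hk.
rewrite mul1r in eQ'.
have it_ge (i : 'I_n.+1) : (k <= i)%N -> iter k (@Phi n) mu i = 0%N.
  move=> ki; rewrite (mnm_nth 0%N) iter_Phi_nth // ltnNge ki /= hmu //.
  by have := ltn_ord i; lia.
have it_lt (i : 'I_n.+1) : (i < k)%N -> (0 < iter k (@Phi n) mu i)%N.
  by move=> ki; rewrite (mnm_nth 0%N) iter_Phi_nth // ki.
have nth0 (j : nat) : nth 0%N (0%MM : 'X_{1..n.+1}) j = 0%N.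
  have [hj|hj] := ltnP j n.+1; last by rewrite nth_default // size_tuple.
  by have := mnm0E (Ordinal hj); rewrite (mnm_nth 0%N).
have it0 (i : 'I_n.+1) : iter k (@Phi n) 0%MM i = (i < k)%N.
  by rewrite (mnm_nth 0%N) iter_Phi_nth // !nth0; case: ltnP.
have chiI : chi (iter k (@Phi n) mu) = iter k (@Phi n) 0%MM.
  apply/mnmP => i; rewrite chiE it0.
  by have [ik|ki] := ltnP i k; [rewrite it_lt|rewrite it_ge].
have dchi : mdeg (chi (iter k (@Phi n) mu)) = k.
  rewrite chiI; elim: (k) => [|m IH]; first by rewrite mdeg0.
  by rewrite iterS mdeg_Phi IH.
exists P', Q'; apply: ChainInv.
- exact: dchi.
- exact: gP'.
- by rewrite eP' eQ'.
- by rewrite chiI.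
- rewrite eQ' => nu hnu.
  have [/existsP[i /andP[ik /eqP z]]|] :=
    boolP [exists i : 'I_n.+1, (i < k)%N && (nu i == 0%N)].
    exact: staircase_vanish ik z.
  rewrite negb_exists => /forallP h; move: hnu; rewrite ltnNge /supp_card.
  rewrite -{1}(card_ord_lt hk) subset_leq_card //; apply/subsetP => i.
  by rewrite !inE => ik; have := h i; rewrite ik lt0n.
- rewrite eQ' => nu bnu dnu hnu; left; apply/esym; apply: leq_mdeg_eq; last by rewrite dchi.
  move=> i; rewrite chiI it0; have [ik|//] := ltnP i k.
  by rewrite lt0n; apply: contraNneq hnu => z; rewrite (staircase_vanish ik z).
- by rewrite eQ' chiI; apply: staircase_neq0 => i ik; rewrite it0 ik.
(* No zero precedes a nonzero part yet, so the symmetry condition holds vacuously. *)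
move=> _ i j ij zi pj; have [jk|kj] := ltnP j k.
  have ik : (i < k)%N by apply: leq_trans jk; rewrite ij.
  by have := it_lt _ ik; rewrite zi.
by rewrite it_ge in pj.
Qed.

End IteratedPhi.

(** * Adding one column and normalising *)

Section Columns.
Variables (F : fieldType) (t : F).
Hypothesis t_neq0 : t != 0.
Hypothesis t_inj : forall k l : nat, t ^- k = t ^- l -> k = l.
Local Notation at1 := (map_mpoly (horner_eval (1 : F))).
Local Notation cst := (map_mpoly (@polyC F)).

Lemma estar_unique n k (g : {mpoly F[n]}) chi0 : (k <= n)%N -> g \is symmetric ->
  (msize g <= k.+1)%N -> vanish_supp t k g -> binary chi0 -> mdeg chi0 = k ->
  (cst g).@[anode t chi0] != 0 -> exists2 c, c != 0 & g = c *: estar t n k.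
Proof.
move=> kn sg zg vg bc dc nz.
have prop := sym_vanish_proportional t_neq0 t_inj sg (estar_sym t n k) zg
  (msize_estar t n k) vg (@estar_vanish _ _ n t_neq0 k) bc dc.
move: nz prop; move: (_.@[_]) => a; move: (_.@[_]) => b nz prop.
have pm m : a * ((estar t n k)@_m)%:P = b * (g@_m)%:P.
  by have := mcoeff_scale_eq m prop; rewrite !mcoeff_map_mpoly.
have [_ l1] := mlead_msym_estar t 1 kn; rewrite msym1m in l1.
(* The leading coefficient of [estar] is 1, so comparison there shows that the ratio of the two
   values in F[q] is a scalar of F. *)
have := pm (mlead (estar t n k)); rewrite l1 polyC1 mulr1 => ea.
exists g@_(mlead (estar t n k)).
  by apply: contraNneq nz => z; rewrite ea z mulr0.
apply/mpolyP => m; rewrite mcoeffZ; have := pm m; rewrite {1}ea -mulrA -polyCM.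
have nb : b != 0 by apply: contraNneq nz => z; rewrite ea z mul0r.
by move/(mulfI nb)/polyC_inj => ->.
Qed.

Lemma column_step n (lam : n.+1.-tuple nat) (lam1 : n.+1.-tuple nat) k f P c :
  sorted geq lam -> lam1 = map predn lam :> seq nat -> k = count (leq 1) lam ->
  f \is symmetric -> Good t (mrev lam1) P -> at1 P = c *: f -> c != 0 ->
  exists Q d, [/\ d != 0, Good t (mrev lam) Q & at1 Q = d *: (estar t n.+1 k * f)].
Proof.
move=> slam e1 ek symf gP eP c0.
have kn : (k <= n.+1)%N by rewrite ek -[X in (_ <= X)%N](size_tuple lam) count_size.
have pos i : (i < k)%N = (0 < nth 0%N lam i)%N by rewrite ek sorted_nth_count.
have nth1 i : nth 0%N lam1 i = (nth 0%N lam i).-1.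
  rewrite e1; have [hi|hi] := ltnP i (size lam); first by rewrite (nth_map 0%N).
  by rewrite !nth_default // size_map.
have zero i : (k <= i)%N -> nth 0%N lam i = 0%N.
  by move=> ki; apply/eqP; rewrite -leqn0 leqNgt -pos -leqNgt.
have hmu i : (i < n.+1 - k)%N -> nth 0%N (mrev lam1) i = 0%N.
  move=> hi; rewrite nth_mrev; last by lia.
  by rewrite nth1 zero //; lia.
have symcf : c *: f \is symmetric by apply: rpredZ.
have [P' [Q' inv]] := chain_start t_neq0 t_inj kn symcf gP eP hmu.
set mu := iter k _ _ in inv.
(* This is (lambda_k, ..., lambda_1, 0, ..., 0). *)
have nmu i : (i < n.+1)%N -> nth 0%N mu i = if (i < k)%N then nth 0%N lam (k - i.+1) else 0%N.
  move=> hi; rewrite /mu iter_Phi_nth //; have [ik|ki] := ltnP i k; last first.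
    by apply: hmu; lia.
  rewrite nth_mrev; last by lia.
  rewrite nth1 prednK; first by congr nth; lia.
  by rewrite -pos; lia.
have inc : incr_supp mu.
  move=> l j lj; rewrite !(mnm_nth 0%N) !nmu //.
  have [lk|//] := ltnP l k; have [jk|//] := ltnP j k.
  by move=> _ _; apply: sorted_nth_geq => //; lia.
have pmu : perm_eq mu lam.
  have -> : mu = rev (take k lam) ++ nseq (n.+1 - k) 0%N :> seq nat.
    have st : size (take k lam) = k by rewrite size_takel // size_tuple.
    apply: (@eq_from_nth _ 0%N) => [|i].
      by rewrite size_mnm size_cat size_rev st size_nseq subnKC.
    rewrite size_mnm => hi; rewrite nmu // nth_cat size_rev st.
    case: ltnP => ik; last by rewrite nth_nseq if_same.
    by rewrite nth_rev st // nth_take //; lia.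
  rewrite -{2}(cat_take_drop k lam); apply: perm_cat; first by rewrite perm_rev.
  suff -> : drop k lam = nseq (n.+1 - k) 0%N by [].
  apply: (@eq_from_nth _ 0%N) => [|i _]; first by rewrite size_drop size_tuple size_nseq.
  by rewrite nth_drop nth_nseq if_same zero // leq_addr.
have [mu' [P2 [Q2 [mm pm inv2]]]] := chain_sort t_neq0 t_inj inc (elimT (issymP _) symcf) inv.
have emu : mu' = mrev lam.
  apply/val_inj/val_inj; apply: (sorted_eq leq_trans anti_leq).
  - exact: weakly_incr_sorted mm.
  - by rewrite /= rev_sorted.
  - by apply: (perm_trans pm); apply: (perm_trans pmu); rewrite /= perm_sym perm_rev.
have gQ2 := ci_good_chi inv2; have dk := ci_deg inv2.
have [||||||d d0 eQ2] := @estar_unique n.+1 k (at1 Q2) (chi mu') kn.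
- exact (chain_final_sym t_neq0 t_inj mm inv2).
- by apply: leq_trans (msize_map_mpoly _ _) _; rewrite -dk; case: gQ2.
- exact: ci_vanish inv2.
- exact: chi_binary.
- exact: dk.
- exact: ci_nonzero inv2.
exists P2, (c * d); split; first by rewrite mulf_neq0.
  by rewrite -emu; apply: ci_good inv2.
rewrite (ci_at1 inv2) eQ2 -!mul_mpolyC rmorphM /=; ring.
Qed.

(** Induction on lambda_1, the number of columns. The scalar [c] is only known to be nonzero. *)
Theorem exists_column_poly n (lam : n.-tuple nat) : sorted geq lam ->
  exists P c, [/\ c != 0, Good t (mrev lam) P
    & at1 P = c *: estar_seq t n (conj_part lam)].
Proof.
have [h] : exists h, h = head 0%N lam by exists (head 0%N lam).
elim: h => [|h IH] in lam *.
  move=> h0 slam; exists 1, 1; split; first exact: oner_neq0.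
    have -> : mrev lam = 0%MM.
      apply/mnmP => i; rewrite mnm0E (mnm_nth 0%N) nth_mrev //; apply/eqP.
      by rewrite -leqn0 (leq_trans (sorted_nth_geq slam (leq0n _))) // nth0 -h0.
    split; first by rewrite mdeg0 msize1.
    by move=> nu; rewrite mdeg0 leqn0 mdeg_eq0 => /eqP ->.
  by rewrite /conj_part -h0 /estar_seq big_nil scale1r rmorph1.
case: n lam IH => [|n] lam IH h1 slam; first by rewrite tuple0 in h1.
have e1 : head 0%N (map_tuple predn lam) = h.
  by move: h1; rewrite /=; case: (tval lam) => //= a s <-.
have s1 : sorted geq (map_tuple predn lam).
  by apply: homo_sorted slam => a b /= ab; lia.
have [P [c [c0 gP eP]]] := IH (map_tuple predn lam) (esym e1) s1.
have [Q [d [d0 gQ eQ]]] := column_step slam (erefl _) (erefl _)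
  (estar_seq_sym t n.+1 _) gP eP c0.
exists Q, d; split=> //.
by rewrite eQ (conj_part_pred (esym h1)) /estar_seq big_cons.
Qed.

Lemma mcoeff_estar_seq_mrev n (lam : n.-tuple nat) : sorted geq lam ->
  (estar_seq t n (conj_part lam))@_(mrev lam) = 1.
Proof.
move=> slam; pose s : 'S_n := perm (@rev_ord_inj n).
have -> : mrev lam = (Multinom lam)#s.
  apply/mnmP => i; rewrite mnmE permE !(mnm_nth 0%N) nth_mrev //.
apply: mcoeff_estar_seq; first exact: conj_part_geq.
by move=> i; rewrite sum_conj_part // (mnm_nth 0%N).
Qed.

(** [P] is divided by its coefficient at [mrev lam]. At q = 1 that coefficient is the nonzero scalar
    [c], so no pole arises. *)
Theorem Estar_value_at1 n (lam : n.-tuple nat) : sorted geq lam ->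
  exists E : {mpoly {fraction {poly F}}[n]},
    unique (is_Estar (tofrac 'X) (tofrac t%:P) (mrev lam)) E /\
    mpoly_value_at1 E (estar_seq t n (conj_part lam)).
Proof.
move=> hlam; have [P [c [c0 [zP vP] eP]]] := exists_column_poly hlam.
have eM m : (P@_m).[1] = c * (estar_seq t n (conj_part lam))@_m.
  by have := congr1 (mcoeff m) eP; rewrite mcoeffZ mcoeff_map_mpoly.
have a1 : (P@_(mrev lam)).[1] = c by rewrite eM mcoeff_estar_seq_mrev // mulr1.
have a0 : tofrac P@_(mrev lam) != 0.
  by rewrite tofrac_eq0; apply: contraNneq c0 => z; rewrite -a1 z horner0.
exists ((tofrac P@_(mrev lam))^-1 *: map_mpoly (@tofrac {poly F}) P).
have Ecoef m : ((tofrac P@_(mrev lam))^-1 *: map_mpoly (@tofrac {poly F}) P)@_m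
    = (tofrac P@_(mrev lam))^-1 * tofrac P@_m.
  by rewrite mcoeffZ mcoeff_map_mpoly.
split; last first.
  move=> m; exists P@_m, P@_(mrev lam); split; first by rewrite a1.
    by rewrite Ecoef mulrC.
  by rewrite eM a1 mulrAC divff ?mul1r.
have EE : is_Estar (tofrac 'X) (tofrac t%:P) (mrev lam)
    ((tofrac P@_(mrev lam))^-1 *: map_mpoly (@tofrac {poly F}) P).
  split.
  - apply: leq_trans (msizeZ_le _ _) _.
    by apply: leq_trans (msize_map_mpoly _ _) zP.
  - by rewrite Ecoef mulVf.
  - move=> nu hnu ne; rewrite mevalZ meval_tofrac //.
    by rewrite vP // rmorph0 mulr0.
split=> // E' EE'; apply: is_Estar_unique EE EE'; last exact: tofrac_generic.
by rewrite tofrac_eq0 polyX_eq0.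
Qed.

End Columns.

(** * Specialisation to the field Q(t) *)

Lemma t_neq0 : t_ != 0.
Proof. by rewrite tofrac_eq0 polyX_eq0. Qed.

Lemma t_expV_inj k l : t_ ^- k = t_ ^- l -> k = l.
Proof.
move/invr_inj/eqP; rewrite -!rmorphXn /= tofrac_eq => /eqP.
by move/(congr1 (fun p : {poly rat} => size p)); rewrite !size_polyXn => -[].
Qed.

Theorem theoremB2 (n : nat) (lam : n.-tuple nat) (hlam : sorted geq lam) :
  exists E : {mpoly Qqt[n]},
    unique (is_Estar q_ tq_ (mrev lam)) E /\
    mpoly_value_at1 E (estar_seq t_ n (conj_part lam)).
Proof. exact (Estar_value_at1 t_neq0 t_expV_inj hlam). Qed.
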